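(* Let $\gamma>1$. Let $u_1,\ldots,u_s\in S^{n-1}$ and $c_1,\ldots,c_s>0$ satisfy $$I_n\preceq A:=\sum_{j=1}^s c_j\,u_j\otimes u_j\preceq\gamma I_n,$$ and set $\kappa_j=c_j\langle A^{-1}u_j,u_j\rangle>0$ for $1\leq j\leq s$. If $f_1,\ldots,f_s:\mathbb{R}\to\mathbb{R}^+$ are measurable functions, then $$\int_{\mathbb{R}^n}\prod_{j=1}^s f_j^{\kappa_j}(\langle x,u_j\rangle)\,dx\leq\gamma^{\frac{n}{2}}\prod_{j=1}^s\left(\int_{\mathbb{R}}f_j(t)\,dt\right)^{\kappa_j}.$$
   Context: $S^{n-1}$ is the Euclidean unit sphere of $\mathbb{R}^n$, $\langle\cdot,\cdot\rangle$ is the Euclidean inner product, $I_n$ is the $n\times n$ identity, and $(u\otimes u)(y)=\langle u,y\rangle u$. For symmetric matrices $A,B$, $A\preceq B$ means $\langle Ax,x\rangle\leq\langle Bx,x\rangle$ for all $x\in\mathbb{R}^n$. $\mathbb{R}^+=[0,\infty)$, and $f_j^{\kappa_j}(t)=(f_j(t))^{\kappa_j}$. Integrals of non-negative functions take values in $[0,+\infty]$, with the usual convention $0\cdot\infty=0$. *)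

(* Defs.v *)
From HB Require Import structures.
From mathcomp Require Import all_boot all_order all_algebra.
From mathcomp Require Import all_classical all_reals all_analysis.
Set Implicit Arguments.
Unset Strict Implicit.
Unset Printing Implicit Defensive.
Import Order.TTheory GRing.Theory Num.Theory.
Local Open Scope classical_set_scope.
Local Open Scope ring_scope.

Definition dot (R : realType) (n : nat) (x y : 'cV[R]_n) : R :=
  \sum_(i < n) x i 0 * y i 0.

(* [`|x|] on matrices is the sup norm in MathComp-Analysis, hence [enorm]. *)
Definition enorm (R : realType) (n : nat) (x : 'cV[R]_n) : R :=
  Num.sqrt (dot x x).

Definition unit_sphere (R : realType) (n : nat) : set 'cV[R]_n :=
  [set u | enorm u = 1].
Arguments unit_sphere : clear implicits.

Definition tensor (R : realType) (n : nat) (u v : 'cV[R]_n) : 'M[R]_n :=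
  u *m v^T.

Lemma tensorE (R : realType) (n : nat) (u y : 'cV[R]_n) :
  tensor u u *m y = dot u y *: u.
Proof.
apply/matrixP => i j; rewrite ord1 -mulmxA [LHS]mxE big_ord1 [RHS]mxE mulrC.
by rewrite mxE; congr (_ * _); apply: eq_bigr => k _; rewrite mxE.
Qed.

Definition loewner_le (R : realType) (n : nat) (A B : 'M[R]_n) : Prop :=
  forall x : 'cV[R]_n, dot (A *m x) x <= dot (B *m x) x.

Definition tuple_cons (R : realType) (n : nat) (p : R * n.-tuple R) :
  n.+1.-tuple R := [tuple of p.1 :: p.2].

Lemma measurable_tuple_cons (R : realType) (n : nat) :
  measurable_fun [set: R * n.-tuple R] (@tuple_cons R n).
Proof. exact: measurable_cons. Qed.

Section lebesgue_cons.
Context (R : realType) (n : nat).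
Variable mu : {sigma_finite_measure set (n.-tuple R) -> \bar R}.
Local Open Scope ereal_scope.

Definition lebesgue_cons : set (n.+1.-tuple R) -> \bar R :=
  pushforward (@lebesgue_measure R \x mu) (@tuple_cons R n).

Let lebesgue_cons0 : lebesgue_cons set0 = 0.
Proof. by rewrite /lebesgue_cons /pushforward preimage_set0 measure0. Qed.

Let lebesgue_cons_ge0 A : 0 <= lebesgue_cons A.
Proof. by apply: integral_ge0 => x _; exact: measure_ge0. Qed.

Let lebesgue_cons_sigma_additive : semi_sigma_additive lebesgue_cons.
Proof.
move=> F mF tF mUF; rewrite /lebesgue_cons /pushforward preimage_bigcup.
have mP (A : set (n.+1.-tuple R)) :
    measurable A -> measurable (@tuple_cons R n @^-1` A).
  by move=> mA; rewrite -[X in measurable X]setTI; exact: measurable_tuple_cons.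
apply: (@measure_semi_sigma_additive _ _ _ (@lebesgue_measure R \x mu)).
- by move=> k; exact: mP.
- apply/trivIsetP => /= i j _ _ ij; rewrite -preimage_setI.
  by move/trivIsetP : tF => /(_ _ _ _ _ ij) ->//; rewrite preimage_set0.
- by rewrite -preimage_bigcup; exact: mP.
Qed.

HB.instance Definition _ := isMeasure.Build _ _ _ lebesgue_cons
  lebesgue_cons0 lebesgue_cons_ge0 lebesgue_cons_sigma_additive.

Let lebesgue_cons_sigma_finite : sigma_finite setT lebesgue_cons.
Proof.
have /sigma_finiteP[F [TF ndF Foo]] := sigma_finiteT (@lebesgue_measure R).
have /sigma_finiteP[G [TG ndG Goo]] := sigma_finiteT mu.
pose h (t : n.+1.-tuple R) : R * n.-tuple R := (thead t, [tuple of behead t]).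
have hK (p : R * n.-tuple R) : h (tuple_cons p) = p.
  by case: p => x t; rewrite /h theadE; congr pair; exact/val_inj.
have mh : measurable_fun [set: n.+1.-tuple R] h.
  apply: measurable_fun_pair; first exact: measurable_tnth.
  exact: measurable_behead.
exists (fun k => h @^-1` (F k `*` G k)).
  rewrite -preimage_bigcup [X in h @^-1` X](_ : _ = setT) ?preimage_setT//.
  apply/seteqP; split=> [//|[x t] _].
  have [k _ Fkx] : (\bigcup_k F k) x by rewrite -TF.
  have [l _ Glt] : (\bigcup_k G k) t by rewrite -TG.
  exists (maxn k l) => //; split=> /=.
    by move: x Fkx; exact/subsetPset/ndF/leq_maxl.
  by move: t Glt; exact/subsetPset/ndG/leq_maxr.
move=> k; have [mFk Fkoo] := Foo k; have [mGk Gkoo] := Goo k; split.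
  by rewrite -[X in measurable X]setTI; apply: mh => //; exact: measurableX.
rewrite /lebesgue_cons /pushforward.
rewrite (_ : @tuple_cons R n @^-1` _ = F k `*` G k); last first.
  by rewrite -comp_preimage (_ : _ \o _ = id)//; exact/funext.
by rewrite product_measure1E// lte_mul_pinfty// ge0_fin_numE.
Qed.

HB.instance Definition _ := Measure_isSigmaFinite.Build _ _ _ lebesgue_cons
  lebesgue_cons_sigma_finite.

End lebesgue_cons.

(* Lebesgue measure on the Borel sets of R^n, as an n-fold product measure. *)
Fixpoint borel_lebesgue (R : realType) (n : nat) :
    {sigma_finite_measure set (n.-tuple R) -> \bar R} :=
  match n with
  | 0 => @dirac _ (0.-tuple R) [tuple] R
  | m.+1 => lebesgue_cons (borel_lebesgue R m)
  end.

Lemma measurable_box (R : realType) (n : nat) (E : 'I_n -> set R) :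
  (forall i, measurable (E i)) ->
  measurable [set t : n.-tuple R | forall i, E i (tnth t i)].
Proof.
move=> mE.
rewrite (_ : [set _ | _] =
    \bigcap_(i in [set: 'I_n]) ((fun t : n.-tuple R => tnth t i) @^-1` E i)).
  apply: fin_bigcap_measurable => [|i _]; first exact: finite_finset.
  by rewrite -[X in measurable X]setTI; exact: measurable_tnth.
by apply/seteqP; split=> [t Et i _|t Et i]; [exact: Et|exact: (Et i)].
Qed.

Lemma borel_lebesgue_box (R : realType) (n : nat) (E : 'I_n -> set R) :
  (forall i, measurable (E i)) ->
  borel_lebesgue R n [set t | forall i, E i (tnth t i)] =
  (\prod_(i < n) lebesgue_measure (E i))%E.
Proof.
elim: n E => [|n IH] E mE.
  rewrite big_ord0 [X in borel_lebesgue _ _ X](_ : _ = setT).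
    exact: diracT.
  by apply/seteqP; split=> // t _ [].
rewrite big_ord_recl -IH//.
have mE' i : measurable (E (lift ord0 i)) by [].
rewrite -(product_measure1E (@lebesgue_measure R) (borel_lebesgue R n)
  (mE ord0) (measurable_box mE')).
rewrite /= /lebesgue_cons /pushforward; congr (product_measure1 _ _ _).
apply/seteqP; split=> -[x t] /=.
  move=> Et; split; first by have := Et ord0; rewrite tnth0.
  by move=> i; have := Et (lift ord0 i); rewrite tnthS.
move=> [E0 Et] i; case: (unliftP ord0 i) => [j|] ->; last by rewrite tnth0.
by rewrite tnthS.
Qed.

(* The completion of [borel_lebesgue], on the Lebesgue measurable sets. *)
Definition lebesgue_Rn (R : realType) (n : nat) :=
  @completed_measure_extension _ _ _ (borel_lebesgue R n).
Arguments lebesgue_Rn : clear implicits.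
HB.instance Definition _ (R : realType) (n : nat) :=
  Measure.on (lebesgue_Rn R n).

Lemma lebesgue_RnE (R : realType) (n : nat) (A : set (n.-tuple R)) :
  measurable A -> lebesgue_Rn R n A = borel_lebesgue R n A.
Proof. by move=> mA; exact: measurable_mu_extE. Qed.

Definition colvec (R : realType) (n : nat) (x : n.-tuple R) : 'cV[R]_n :=
  \col_i tnth x i.

(* The domain carries the sigma-algebra of [completed_lebesgue_measure];
   MathComp's default [measurable_fun] on [R] would mean Borel measurable. *)
Definition lebesgue_measurable_fun (R : realType) (f : R -> R) : Prop :=
  measurable_fun
    [set: caratheodory_type ((@wlength R idfun)^*)%mu] f.

(* Main.v *)
Require Import Defs.
From mathcomp Require Import all_boot all_order all_algebra all_fingroup.
From mathcomp Require Import ring lra.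
From mathcomp Require Import all_classical all_reals all_analysis measurable_realfun.

(* Barthe's transport proof of the rank-one Brascamp-Lieb inequality. Let
   rho_j = <A^-1 u_j, u_j>, so that kappa_j = c_j rho_j and the kappa_j add up to
   n. If T_j transports f_j / (integral of f_j) to the Gaussian density
   proportional to exp(-t^2 / rho_j), put Theta(x) = sum_j c_j T_j(<x, u_j>) u_j.
   Then <A^-1 Theta, Theta> <= sum_j c_j T_j^2, and
   det(D Theta) >= det A * prod_j (T_j')^kappa_j, so the integrand is dominated,
   up to constants, by exp(-<A^-1 Theta, Theta>) det(D Theta). As Theta is
   injective, this integrates to at most the Gaussian integral, and the constant
   obtained, (det A * prod_j rho_j^kappa_j)^(-1/2), is at most gamma^(n/2) since
   det A >= 1 and rho_j >= 1 / gamma.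

   Nonlinear changes of variables are avoided by replacing each f_j with a step
   function and the Gaussian with a lower Riemann sum: the T_j are then piecewise
   affine, Theta is affine with positive definite linear part on finitely many
   cells, and the images of these cells are disjoint. Step functions dominating
   f_j are obtained from coverings of its level sets by intervals, so that only
   the step functions, and not f_j itself, need be composed with x |-> <x, u_j>;
   Fatou's lemma concludes. *)

Set Implicit Arguments.
Unset Strict Implicit.
Unset Printing Implicit Defensive.
Import Order.TTheory GRing.Theory Num.Theory.
Local Open Scope classical_set_scope.
Local Open Scope ring_scope.

(** * Quadratic forms and Cholesky factors *)

Section inner_product.
Context (R : realType) (n : nat).
Implicit Types (x y z : 'cV[R]_n) (M : 'M[R]_n).

Lemma dotE x y : dot x y = (x^T *m y) 0 0.
Proof. by rewrite mxE; apply: eq_bigr => i _; rewrite mxE. Qed.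

Lemma dotC x y : dot x y = dot y x.
Proof. by apply: eq_bigr => i _; rewrite mulrC. Qed.

Lemma dotDl x y z : dot (x + y) z = dot x z + dot y z.
Proof. by rewrite -big_split; apply: eq_bigr => i _; rewrite mxE mulrDl. Qed.

Lemma dotZl a x y : dot (a *: x) y = a * dot x y.
Proof. by rewrite mulr_sumr; apply: eq_bigr => i _; rewrite mxE mulrA. Qed.

Lemma dotBl x y z : dot (x - y) z = dot x z - dot y z.
Proof. by rewrite dotDl -scaleN1r dotZl mulN1r. Qed.

Lemma dotZr a x y : dot x (a *: y) = a * dot x y.
Proof. by rewrite dotC dotZl dotC. Qed.

Lemma dotBr x y z : dot z (x - y) = dot z x - dot z y.
Proof. by rewrite dotC dotBl !(dotC _ z). Qed.

Lemma dot0l x : dot 0 x = 0.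
Proof. by rewrite -(scale0r 0) dotZl mul0r. Qed.

Lemma dot_suml (I : finType) (F : I -> 'cV[R]_n) y :
  dot (\sum_i F i) y = \sum_i dot (F i) y.
Proof. by elim/big_rec2: _ => [|i a b _ <-]; rewrite ?dot0l ?dotDl. Qed.

Lemma dot_ge0 x : 0 <= dot x x.
Proof. by apply: sumr_ge0 => i _; rewrite -expr2 sqr_ge0. Qed.

Lemma dot_eq0 x : (dot x x == 0) = (x == 0).
Proof.
apply/idP/eqP => [|->]; last by rewrite dot0l.
rewrite psumr_eq0 => [/allP x0|i _]; last by rewrite -expr2 sqr_ge0.
apply/matrixP => i j; rewrite ord1 mxE.
by have := x0 i (mem_index_enum _); rewrite /= -expr2 sqrf_eq0 => /eqP.
Qed.

Lemma dot_trmx M x y : dot (M^T *m x) y = dot x (M *m y).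
Proof. by rewrite !dotE trmx_mul trmxK mulmxA. Qed.

Lemma tensor_sym x : (tensor x x)^T = tensor x x.
Proof. by rewrite trmx_mul trmxK. Qed.

End inner_product.

Section positive_matrices.
Context (R : realType).

(** The top entry of [x] is chosen to make the top entry of [M *m x] vanish, so that only the Schur
    complement of [a] is left. *)
Lemma dot_block n (a : R) (b y : 'cV[R]_n) (C : 'M[R]_n) : a != 0 ->
  let M := block_mx a%:M b^T b C in
  let x := col_mx (- a^-1 *: (b^T *m y)) y in
  dot (M *m x) x = dot ((C - a^-1 *: (b *m b^T)) *m y) y.
Proof.
move=> a0 /=; rewrite mul_block_col.
have -> : a%:M *m (- a^-1 *: (b^T *m y)) + b^T *m y = 0.
  by rewrite mul_scalar_mx scalerA mulrN divff// scaleN1r addNr.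
rewrite !dotE tr_col_mx mul_row_col trmx0 mul0mx add0r.
congr ((_^T *m _) _ _).
by rewrite mulmxBl addrC -scalemxAr mulmxA -scalemxAl scaleNr.
Qed.

(** Induction on the size, passing to the Schur complement of the top left entry. The last clause
    serves to bound the determinant of the frame from below without eigenvalues. *)
Lemma cholesky n (M : 'M[R]_n) : M^T = M ->
  (forall x, x != 0 -> 0 < dot (M *m x) x) ->
  exists B : 'M[R]_n, [/\ is_trig_mx B, forall i, 0 < B i i, M = B *m B^T &
    loewner_le 1%:M M -> forall i, 1 <= B i i].
Proof.
elim: n M => [|n IH] M Msym Mpos.
  exists 0; split; [exact: mx0_is_trig|by case|by apply/matrixP; case|].
  by move=> _ [].
move: M Msym Mpos; change n.+1 with (1 + n)%N => M Msym Mpos.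
pose a := M 0 0; pose b : 'cV[R]_n := dlsubmx M; pose C : 'M[R]_n := drsubmx M.
have ME : M = block_mx a%:M b^T b C.
  rewrite -[LHS]submxK; congr block_mx; last by rewrite /b trmx_dlsub Msym.
  by apply/matrixP => i j; rewrite !ord1 !mxE eqxx mulr1n /a; congr (M _ _);
    exact/val_inj.
have dot_head (N : 'M[R]_(1 + n)) :
    dot (N *m delta_mx 0 0) (delta_mx 0 0) = N 0 0.
  rewrite -colE dotC dotE trmx_delta -rowE !mxE.
  by [].
have a_gt0 : 0 < a.
  rewrite /a -dot_head; apply: Mpos; apply/eqP => /matrixP/(_ 0 0).
  by rewrite !mxE !eqxx; apply/eqP; rewrite oner_eq0.
pose S := C - a^-1 *: (b *m b^T).
have Csym : C^T = C by rewrite trmx_drsub Msym.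
have Ssym : S^T = S.
  by rewrite /S linearB/= linearZ/= trmx_mul trmxK Csym.
have Spos y : y != 0 -> 0 < dot (S *m y) y.
  move=> y0; rewrite /S -dot_block ?gt_eqF// -ME; apply: Mpos.
  apply: contra_neq y0 => /(congr1 dsubmx); rewrite col_mxKd => ->.
  by rewrite linear0.
have [B [Btrig Bpos SE B1]] := IH S Ssym Spos.
pose r := Num.sqrt a.
have r_gt0 : 0 < r by rewrite sqrtr_gt0.
have rr : r * r = a by rewrite -expr2 sqr_sqrtr// ltW.
have Bdiag i : (block_mx r%:M 0 (r^-1 *: b) B : 'M[R]_(1 + n)) i i =
    if fintype.split i is inr k then B k k else r.
  rewrite -[in LHS](fintype.splitK i); case: (fintype.split i) => k /=.
    by rewrite block_mxEul ord1 mxE eqxx mulr1n.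
  by rewrite block_mxEdr.
exists (block_mx r%:M 0 (r^-1 *: b) B); split.
- by rewrite is_trig_block_mx// eqxx Btrig scalar_mx_is_trig.
- by move=> i; rewrite Bdiag; case: fintype.split.
- rewrite tr_block_mx mulmx_block ME !trmx0 !mulmx0 !mul0mx !addr0 tr_scalar_mx.
  rewrite -scalar_mxM rr; congr block_mx.
  + rewrite linearZ/= mul_scalar_mx scalerA divff ?gt_eqF//.
    by rewrite scale1r.
  + by rewrite mul_mx_scalar scalerA divff ?gt_eqF// scale1r.
  + rewrite -SE /S linearZ/= -scalemxAl -scalemxAr scalerA -invfM rr.
    by rewrite addrC subrK.
- move=> M1 i; rewrite Bdiag; case: fintype.split => [_|k].
    have := M1 (delta_mx 0 0); rewrite !dot_head mxE eqxx mulr1n -/a.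
    by move=> a1; rewrite -sqrtr1 ler_wsqrtr.
  (* The vector completing [y] in [dot_block] is at least as long as [y], so the Schur complement
     inherits the lower bound by the identity. *)
  apply: B1 => y; rewrite /S -dot_block ?gt_eqF// -ME.
  apply: le_trans (M1 _); rewrite !mul1mx ![dot _ _]dotE.
  rewrite tr_col_mx mul_row_col [leRHS]mxE lerDr -dotE.
  exact: dot_ge0.
Qed.

End positive_matrices.

(** * The determinant inequality *)

Section determinant_inequality.
Context (R : realType) (n s : nat) (u : 'I_s -> 'cV[R]_n).
Local Notation maps := {ffun 'I_n -> 'I_s}.
Implicit Types (l c : 'I_s -> R) (phi : maps).

(** With weights [c] this is the matrix A of the theorem; with [c j] times the slopes of the T_j it
    is the linear part of Theta on a cell. *)
Definition weighted_frame l : 'M[R]_n := \sum_(j < s) l j *: tensor (u j) (u j).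

Let rows phi : 'M[R]_n := \matrix_(i, k) u (phi i) k 0.

(** Row i of the frame is the sum over j of [l j * u j i 0] times the row u_j^T; expanding all rows
    by multilinearity selects one index phi(i) per row. *)
Let det_expand l : \det (weighted_frame l) =
  \sum_(phi : maps) (\prod_i l (phi i)) * (\prod_i u (phi i) i 0) * \det (rows phi).
Proof.
rewrite /determinant.
under [RHS]eq_bigr do rewrite mulr_sumr.
rewrite [RHS]exchange_big /=; apply: eq_bigr => p _.
transitivity ((-1) ^+ p *
    \prod_(i < n) \sum_j (l j * u j i 0 * u j (p i) 0)).
  congr (_ * _); apply: eq_bigr => i _; rewrite summxE; apply: eq_bigr => j _.
  by rewrite !mxE big_ord1 !mxE mulrA.
rewrite bigA_distr_bigA mulr_sumr; apply: eq_bigr => phi _.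
rewrite [X in _ * (_ * X)](eq_bigr (fun i => u (phi i) (p i) 0)) => [|i _];
  last by rewrite mxE.
by rewrite !big_split /= mulrCA.
Qed.

(* A Cauchy-Binet formula, summed over maps rather than over [n]-subsets. *)
Lemma det_weighted_frame l : \det (weighted_frame l) =
  n`!%:R^-1 * \sum_(phi : maps) (\prod_i l (phi i)) * \det (rows phi) ^+ 2.
Proof.
have nf0 : n`!%:R != 0 :> R by rewrite pnatr_eq0 -lt0n fact_gt0.
apply: (mulfI nf0); rewrite mulrA divff// mul1r.
(* Each of the n! equal copies is reindexed by phi -> phi o p; the signs and coordinates then sum
   over p to a second factor [\det (rows phi)]. *)
transitivity (\sum_(p : 'S_n) \det (weighted_frame l)).
  by rewrite sumr_const card_Sn mulr_natl.
pose act (p : 'S_n) phi : {ffun 'I_n -> 'I_s} := [ffun i => phi (p i)].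
have actK p : cancel (act p) (act p^-1%g).
  by move=> phi; apply/ffunP => i; rewrite !ffunE permKV.
transitivity (\sum_(p : 'S_n) \sum_(phi : maps) (\prod_i l (phi i)) *
    ((-1) ^+ p * \prod_i rows phi (p i) i * \det (rows phi))).
  apply: eq_bigr => p _; rewrite det_expand (reindex_inj (can_inj (actK p))) /=.
  apply: eq_bigr => phi _.
  have -> : rows (act p phi) = row_perm p (rows phi).
    by apply/matrixP => i k; rewrite !mxE ffunE.
  rewrite row_permE det_mulmx det_perm -!mulrA; congr (_ * _).
    rewrite [RHS](reindex_inj (@perm_inj _ p)) /=.
    by apply: eq_bigr => i _; rewrite ffunE.
  rewrite mulrCA; congr (_ * (_ * _)).
  by apply: eq_bigr => i _; rewrite mxE ffunE.
rewrite exchange_big /=; apply: eq_bigr => phi _.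
rewrite -mulr_sumr; congr (_ * _); rewrite -mulr_suml expr2; congr (_ * _).
rewrite -det_tr; apply: eq_bigr => p _; congr (_ * _).
by apply: eq_bigr => i _; rewrite [in RHS]mxE.
Qed.

(** Both sides of [LU] are products of block triangular matrices, whose determinants can be read
    off. *)
Lemma det_add1_outer (x y : 'cV[R]_n) :
  \det (1%:M + x *m y^T) = 1 + dot y x.
Proof.
have LU : block_mx (1%:M + x *m y^T) (- x) 0 1%:M *m block_mx 1%:M 0 y^T 1%:M
   = block_mx 1%:M 0 y^T 1%:M *m block_mx 1%:M (- x) 0 (1%:M + y^T *m x) :> 'M[R]_(n + 1).
  rewrite !mulmx_block !mul1mx !mulmx1 !mulmx0 !mul0mx !addr0 !add0r.
  by rewrite mulNmx addrK mulmxN addrCA addNr addr0.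
have := congr1 determinant LU.
rewrite !det_mulmx !det_ublock !det_lblock !det1 !mulr1 !mul1r => ->.
by rewrite det_mx11 !mxE eqxx dotE mxE.
Qed.

Variable c : 'I_s -> R.
Hypothesis c_gt0 : forall j, 0 < c j.
Let A := weighted_frame c.
Hypothesis detA : 0 < \det A.
Let kappa j := c j * dot (invmx A *m u j) (u j).

(** The trace of A^-1 A, computed term by term. *)
Lemma sum_kappa : \sum_j kappa j = n%:R.
Proof.
have Au : A \in unitmx by rewrite unitmxE unitfE gt_eqF.
rewrite -(@mxtrace1 R n) -(mulVmx Au) {2}/A /weighted_frame mulmx_sumr raddf_sum.
apply: eq_bigr => j _ /=.
rewrite -scalemxAr mxtraceZ /kappa; congr (_ * _).
by rewrite /tensor mulmxA mxtrace_mulC dotC dotE /mxtrace big_ord1.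
Qed.

(** The Cauchy-Binet terms of det A divided by det A: a probability distribution on the maps phi,
    under which [kappa j] is the expected number of times that the value j is taken. *)
Let w phi := n`!%:R^-1 * (\prod_i c (phi i)) * \det (rows phi) ^+ 2 / \det A.

Let w_ge0 phi : 0 <= w phi.
Proof.
rewrite /w divr_ge0 ?(ltW detA)// mulr_ge0 ?sqr_ge0// mulr_ge0 ?invr_ge0//.
by apply: prodr_ge0 => i _; exact: ltW.
Qed.

Let detA_neq0 : \det A != 0. Proof. by rewrite gt_eqF. Qed.

Let det_weights l : \det (weighted_frame (fun j => c j * l j)) =
  \det A * \sum_(phi : maps) w phi * \prod_i l (phi i).
Proof.
rewrite det_weighted_frame !mulr_sumr; apply: eq_bigr => phi _.
rewrite /w big_split/=.
move: (\prod_i c (phi i)) (\prod_i l (phi i)) (\det (rows phi)) => a b d.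
by move: n`!%:R^-1 (\det A) detA_neq0 => k D D0; field.
Qed.

Let sum_w : \sum_(phi : maps) w phi = 1.
Proof.
apply: (mulfI detA_neq0); rewrite mulr1.
rewrite [RHS](_ : _ = \det (weighted_frame (fun j => c j * 1))).
  rewrite det_weights; congr (_ * _); apply: eq_bigr => phi _.
  by rewrite big1 ?mulr1.
by congr (\det _); apply: eq_bigr => j _; rewrite mulr1.
Qed.

(* A map taking the value [j] twice has weight 0, so doubling [c j] scales the
   weight of [phi] by [1 + #|{i | phi i = j}|]; compare with the rank-one
   update formula. *)
Let sum_w_count j : \sum_(phi : maps) w phi * \sum_i (phi i == j)%:R = kappa j.
Proof.
apply: (mulfI detA_neq0).
have := det_weights (fun k => 1 + (k == j)%:R).
have -> : weighted_frame (fun k => c k * (1 + (k == j)%:R)) =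
    A *m (1%:M + (c j *: (invmx A *m u j)) *m (u j)^T).
  have Au : A \in unitmx by rewrite unitmxE unitfE gt_eqF.
  rewrite mulmxDr mulmx1 -scalemxAl -scalemxAr !mulmxA mulmxV// mul1mx.
  rewrite /weighted_frame (bigD1 j)//= eqxx mulrDr mulr1 scalerDl addrAC.
  congr (_ + _); rewrite /A /weighted_frame [in RHS](bigD1 j)//=; congr (_ + _).
  by apply: eq_bigr => k /negPf ->; rewrite addr0 mulr1.
rewrite det_mulmx det_add1_outer dotZr (dotC (u j)) -/(kappa j) => H.
move/(mulfI detA_neq0) : H => H.
congr (_ * _); apply: (addrI 1); rewrite H -{1}sum_w -big_split /=.
apply: eq_bigr => phi _; rewrite -{1}(mulr1 (w phi)) -mulrDr.
have [->|w0] := eqVneq (w phi) 0; first by rewrite !mul0r.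
congr (_ * _).
have phi_inj i k : phi i = j -> phi k = j -> i = k.
  move=> pi pk; apply: contraNeq w0 => ik; rewrite /w.
  rewrite (determinant_alternate ik) ?expr0n ?mulr0 ?mul0r// => m.
  by rewrite !mxE pi pk.
have [/existsP[i /eqP pi]|] := boolP [exists i, phi i == j]; last first.
  move=> /existsPn nj; rewrite !big1 ?addr0// => i _.
    by rewrite (negPf (nj i)) addr0.
  by rewrite (negPf (nj i)).
have npj k : k != i -> (phi k == j) = false.
  by move=> ki; apply: contraNF ki => /eqP pk; apply/eqP; exact: phi_inj.
rewrite (bigD1 i)//= [in RHS](bigD1 i)//= pi eqxx !big1 ?addr0 ?mulr1//.
  by move=> k ki; rewrite npj// addr0.
by move=> k ki; rewrite npj.
Qed.

(** Jensen's inequality for exp under the weights [w]: the quotient of the two determinants is the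
    mean of exp(tau), where tau has mean [t0]. *)
Lemma det_weighted_frame_ge l : (forall j, 0 < l j) ->
  \det A * \prod_j l j `^ kappa j <= \det (weighted_frame (fun j => c j * l j)).
Proof.
move=> l_gt0; rewrite det_weights ler_pM2l//.
pose tau phi := \sum_i ln (l (phi i)); pose t0 := \sum_j kappa j * ln (l j).
have -> : \prod_j l j `^ kappa j = expR t0.
  by rewrite expR_sum; apply: eq_bigr => j _; rewrite /powR gt_eqF.
have tauE phi : \prod_i l (phi i) = expR (tau phi).
  by rewrite expR_sum; apply: eq_bigr => i _; rewrite lnK// posrE.
have sum_tau : \sum_(phi : maps) w phi * tau phi = t0.
  rewrite /t0; under [RHS]eq_bigr do rewrite -sum_w_count mulr_suml.
  rewrite exchange_big /=; apply: eq_bigr => phi _.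
  under [RHS]eq_bigr do rewrite -mulrA.
  rewrite -mulr_sumr; congr (_ * _).
  under [RHS]eq_bigr do rewrite mulr_suml.
  rewrite exchange_big /=; apply: eq_bigr => i _.
  rewrite (bigD1 (phi i))//= eqxx mul1r big1 ?addr0// => k /negPf.
  by rewrite eq_sym => ->; rewrite mul0r.
(* Divided by exp(t0), the tangent line of exp at [t0] is 1 + (tau - t0), which has mean 1; exp lies
   above it. *)
have sum1 : 1 = \sum_(phi : maps) w phi * (1 + (tau phi - t0)).
  under eq_bigr do rewrite mulrDr mulr1 mulrBr.
  by rewrite big_split sumrB /= sum_tau sum_w -mulr_suml sum_w mul1r subrr addr0.
rewrite -[leLHS]mulr1 [X in _ * X <= _]sum1.
rewrite mulr_sumr; apply: ler_sum => phi _; rewrite mulrCA ler_wpM2l//.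
rewrite tauE -[tau phi in leRHS](subrK t0) expRD mulrC ler_pM2r ?expR_gt0//.
exact: expR_ge1Dx.
Qed.

End determinant_inequality.

(** * Consequences of the bounds on the frame matrix *)

Section frame.
Context (R : realType) (n s : nat) (u : 'I_s -> 'cV[R]_n) (c : 'I_s -> R).
Hypothesis c_gt0 : forall j, 0 < c j.
Let A := weighted_frame u c.

Lemma weighted_frame_sym l : (weighted_frame u l)^T = weighted_frame u l.
Proof.
rewrite /weighted_frame raddf_sum; apply: eq_bigr => j _ /=.
by rewrite linearZ/= tensor_sym.
Qed.

Lemma dot_weighted_frame l x y : dot (weighted_frame u l *m x) y =
  \sum_j l j * dot (u j) x * dot (u j) y.
Proof.
rewrite mulmx_suml dot_suml; apply: eq_bigr => j _.
by rewrite -scalemxAl tensorE scalerA dotZl.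
Qed.

Hypothesis A_ge1 : loewner_le 1%:M A.

(** A zero x of the form is orthogonal to every u_j, so <Ax, x> = 0, and A >= I forces x = 0. *)
Lemma weighted_frame_gt0 l : (forall j, 0 < l j) ->
  forall x, x != 0 -> 0 < dot (weighted_frame u l *m x) x.
Proof.
move=> l_gt0 x x0; rewrite lt_def dot_weighted_frame.
have pos j : true -> 0 <= l j * dot (u j) x * dot (u j) x.
  by move=> _; rewrite -mulrA mulr_ge0 ?(ltW (l_gt0 j))// -expr2 sqr_ge0.
rewrite sumr_ge0// andbT psumr_eq0//; apply: contraNN x0 => /allP ux0.
rewrite -dot_eq0 eq_le dot_ge0 andbT.
rewrite -{1}(mul1mx x); apply: (le_trans (A_ge1 x)).
rewrite dot_weighted_frame big1// => j _.
have := ux0 j (mem_index_enum _); rewrite /= -mulrA mulf_eq0 gt_eqF//= -mulrA.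
by move=> /eqP->; rewrite mulr0.
Qed.

(** The determinant is the product of the squared diagonal entries of the Cholesky factor, each at
    least 1. *)
Lemma det_frame_ge1 : 1 <= \det A.
Proof.
have [B [Bt _ AE B1]] :=
  cholesky (weighted_frame_sym c) (weighted_frame_gt0 c_gt0).
rewrite /A AE det_mulmx det_tr det_trig// -[leLHS]mulr1.
have p1 : 1 <= \prod_i B i i.
  elim/big_rec: _ => // i y _ y1; rewrite -[leLHS]mulr1.
  by apply: ler_pM => //; exact: B1.
by apply: ler_pM.
Qed.

Lemma frame_unit : A \in unitmx.
Proof. by rewrite unitmxE unitfE gt_eqF// (lt_le_trans _ det_frame_ge1). Qed.

(** With z = A^-1 y, the difference of the two sides is the sum of the squares (t_j - <u_j, z>)^2
    weighted by c_j. *)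
Lemma dot_invmx_frame_sum (t : 'I_s -> R) :
  let y := \sum_j (c j * t j) *: u j in
  dot (invmx A *m y) y <= \sum_j c j * t j ^+ 2.
Proof.
move=> /=; set y := \sum_j _; pose z := invmx A *m y; rewrite -/z -subr_ge0.
have zy : dot z y = \sum_j c j * t j * dot (u j) z.
  rewrite dotC /y dot_suml; apply: eq_bigr => j _; exact: dotZl.
have zz : dot z y = \sum_j c j * dot (u j) z * dot (u j) z.
  by rewrite -dot_weighted_frame -/A mulKVmx ?frame_unit// dotC.
rewrite (_ : _ - _ = \sum_j c j * (t j - dot (u j) z) ^+ 2).
  by apply: sumr_ge0 => j _; rewrite mulr_ge0 ?sqr_ge0// ltW.
rewrite (_ : _ - dot z y = \sum_j c j * t j ^+ 2 - dot z y *+ 2 + dot z y);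
  last by rewrite mulr2n; ring.
rewrite {1}zy zz -sumrMnl -sumrB -big_split; apply: eq_bigr => j _ /=.
by ring.
Qed.

(** With z = A^-1 x, the form of A at z - x/g is nonnegative; it expands to <z, x> - 2/g + <Ax,
    x>/g^2, where <Ax, x> <= g. *)
Lemma frame_rho_ge (g : R) : 0 < g -> loewner_le A g%:M ->
  forall x, dot x x = 1 -> g^-1 <= dot (invmx A *m x) x.
Proof.
move=> g0 Ag x x1; pose z := invmx A *m x; rewrite -/z.
have zA : A *m z = x by rewrite mulKVmx ?frame_unit.
have : 0 <= dot (A *m (z - g^-1 *: x)) (z - g^-1 *: x).
  rewrite dot_weighted_frame sumr_ge0// => j _.
  by rewrite -mulrA mulr_ge0 ?(ltW (c_gt0 j))// -expr2 sqr_ge0.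
rewrite mulmxBr zA -scalemxAr dotBl !dotBr !dotZl !dotZr x1 (dotC x).
have -> : dot (A *m x) z = 1 by rewrite -{1}(weighted_frame_sym c : A^T = A) dot_trmx zA.
have : dot (A *m x) x <= g.
  by apply: le_trans (Ag x) _; rewrite mul_scalar_mx dotZl x1 mulr1.
rewrite -(ler_pM2l (_ : 0 < g^-1 * g^-1)) ?mulr_gt0 ?invr_gt0// => Hle.
have e : g^-1 * g^-1 * g = g^-1 by rewrite -mulrA mulVf ?mulr1// gt_eqF.
rewrite e in Hle; lra.
Qed.

End frame.

(** * Affine changes of variables *)

Section affine_line.
Context (R : realType).
Local Notation mu := (@lebesgue_measure R).

Lemma measurable_affine (a b : R) :
  measurable_fun [set: measurableTypeR R]
    ((fun x => a * x + b) : measurableTypeR R -> measurableTypeR R).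
Proof. by apply: measurable_funD => //; exact: measurable_funM. Qed.

(** The image of Lebesgue measure under the affine map, scaled by [a], agrees with Lebesgue measure
    on half-open intervals, hence equals it. *)
Lemma ge0_integral_affine (a b : R) (h : R -> \bar R) : 0 < a ->
  measurable_fun [set: R] h -> (forall x, 0 <= h x)%E ->
  (a%:E * \int[mu]_x h (a * x + b)%R = \int[mu]_x h x)%E.
Proof.
move=> a0 mh h0.
pose phi (x : measurableTypeR R) : measurableTypeR R := a * x + b.
have mphi : measurable_fun setT phi by exact: measurable_affine.
pose pf : {measure set (measurableTypeR R) -> \bar R} := pushforward mu phi.
pose m := mscale (NngNum (ltW a0)) (pf mphi).
transitivity (\int[m]_x h x)%E; last first.
  apply: eq_measure_integral => A mA _; apply/esym.
  apply: lebesgue_measure_unique => //= _ [[p q]] _ <-.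
  have pre : phi @^-1` `]p, q]%classic =
      `](p - b) / a, (q - b) / a]%classic.
    apply/seteqP; split => x /=; rewrite /phi !in_itv/= ltr_pdivrMr// ler_pdivlMr//;
      by rewrite ltrBlDr lerBrDr (mulrC a).
  rewrite /m /mscale /= /pushforward pre.
  rewrite !lebesgue_measure_itv /= !lte_fin ltr_pM2r ?invr_gt0// ltrD2r.
  case: ifPn => _; last by rewrite mule0.
  by rewrite -!EFinD -EFinM; congr EFin; field; rewrite gt_eqF.
rewrite /m ge0_integral_mscale//=; congr (_ * _)%E.
by rewrite ge0_integral_pushforward//; exact: measurable_affine.
Qed.

End affine_line.

Section affine_change_of_variables.
Context (R : realType).
Local Notation leb n := (borel_lebesgue R n).

Lemma measurable_colvec n (i : 'I_n) :
  measurable_fun [set: n.-tuple R] (fun x => colvec x i 0).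
Proof.
under eq_fun do rewrite mxE.
exact: measurable_tnth.
Qed.

Lemma measurable_dot_colvec n (v : 'cV[R]_n) :
  measurable_fun [set: n.-tuple R] (fun x => dot (colvec x) v).
Proof.
by apply: measurable_sum => i; apply: measurable_funM => //;
  exact: measurable_colvec.
Qed.

Lemma integral_lebesgue_cons n (h : n.+1.-tuple R -> \bar R) :
  measurable_fun setT h -> (forall x, 0 <= h x)%E ->
  (\int[leb n.+1]_x h x =
   \int[@lebesgue_measure R \x leb n]_z h (tuple_cons z))%E.
Proof.
move=> mh h0.
have -> : (\int[leb n.+1]_x h x =
    \int[pushforward (@lebesgue_measure R \x leb n) (@tuple_cons R n)]_x h x)%E.
  by [].
by rewrite ge0_integral_pushforward//; exact: measurable_tuple_cons.
Qed.

Lemma integral_tuple_cons n (h : n.+1.-tuple R -> \bar R) :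
  measurable_fun setT h -> (forall x, 0 <= h x)%E ->
  (\int[leb n.+1]_x h x =
   \int[@lebesgue_measure R]_t \int[leb n]_x h (tuple_cons (t, x)))%E.
Proof.
move=> mh h0.
transitivity (\int[@lebesgue_measure R \x leb n]_z h (tuple_cons z))%E.
  exact: integral_lebesgue_cons.
rewrite fubini_tonelli1//.
apply: measurableT_comp => //; exact: measurable_tuple_cons.
Qed.

(** Both orders of integration serve: a lower triangular map is affine in the remaining coordinates
    once the first is fixed, its transpose is affine in the first once the others are fixed. *)
Lemma integral_tuple_cons_sym n (h : n.+1.-tuple R -> \bar R) :
  measurable_fun setT h -> (forall x, 0 <= h x)%E ->
  (\int[leb n.+1]_x h x =
   \int[leb n]_x \int[@lebesgue_measure R]_t h (tuple_cons (t, x)))%E.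
Proof.
move=> mh h0.
transitivity (\int[@lebesgue_measure R \x leb n]_z h (tuple_cons z))%E.
  exact: integral_lebesgue_cons.
rewrite fubini_tonelli2//.
apply: measurableT_comp => //; exact: measurable_tuple_cons.
Qed.

Definition tuple_of_col n (v : 'cV[R]_n) : n.-tuple R := [tuple v i 0 | i < n].

Lemma colvecK n : cancel (@colvec R n) (@tuple_of_col n).
Proof. by move=> x; apply: eq_from_tnth => i; rewrite tnth_mktuple mxE. Qed.

Lemma tuple_of_colK n : cancel (@tuple_of_col n) (@colvec R n).
Proof. by move=> v; apply/colP => i; rewrite mxE tnth_mktuple. Qed.

Lemma tuple_of_col_mx n (t : 'M[R]_1) (v : 'cV[R]_n) :
  tuple_of_col (col_mx t v : 'cV_(1 + n)) = tuple_cons (t 0 0, tuple_of_col v).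
Proof.
apply: eq_from_tnth => i; rewrite tnth_mktuple.
case: (unliftP ord0 i) => [j|] ->.
  rewrite [RHS]tnthS tnth_mktuple.
  by rewrite (_ : lift ord0 j = rshift 1 j) ?col_mxEd//; exact: val_inj.
rewrite [RHS]tnth0 (_ : ord0 = lshift n (0 : 'I_1)) ?col_mxEu//.
exact: val_inj.
Qed.

Lemma colvec_cons n t (x : n.-tuple R) :
  colvec (tuple_cons (t, x)) = col_mx t%:M (colvec x) :> 'cV_(1 + n).
Proof.
by rewrite -[RHS]tuple_of_colK tuple_of_col_mx mxE eqxx mulr1n colvecK.
Qed.

Definition affine_tuple n (B : 'M[R]_n) (b : 'cV[R]_n) (x : n.-tuple R) :=
  tuple_of_col (B *m colvec x + b).

Lemma measurable_affine_tuple n (B : 'M[R]_n) b :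
  measurable_fun setT (affine_tuple B b).
Proof.
apply/measurable_fun_tnthP => i.
rewrite [_ \o _](_ : _ = fun x => \sum_k B i k * colvec x k 0 + b i 0).
  apply: measurable_funD => //; apply: measurable_sum => k.
  by apply: measurable_funM => //; exact: measurable_colvec.
by apply/funext => x; rewrite /= tnth_mktuple !mxE.
Qed.

(** No absolute value is taken, as the matrices met below have positive determinant. The shift [b]
    is quantified inside because the induction on triangular matrices creates shifts depending on
    the coordinate split off. *)
Definition change_of_variables n (B : 'M[R]_n) := forall b h,
  measurable_fun [set: n.-tuple R] h -> (forall x, 0 <= h x)%E ->
  ((\det B)%:E * \int[leb n]_x h (affine_tuple B b x) = \int[leb n]_x h x)%E.

Lemma change_of_variables_mul n (B C : 'M[R]_n) :
  change_of_variables B -> change_of_variables C ->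
  change_of_variables (B *m C).
Proof.
move=> HB HC b h mh h0; rewrite -(HB b h)// det_mulmx EFinM -muleA; congr (_ * _)%E.
rewrite -(HC 0 (h \o affine_tuple B b)) //=.
  congr (_ * _)%E; apply: eq_integral => x _; congr (h _).
  by rewrite /affine_tuple tuple_of_colK addr0 mulmxA.
by apply: measurableT_comp => //; exact: measurable_affine_tuple.
Qed.

Lemma change_of_variables_trig n (B : 'M[R]_n) :
  is_trig_mx B -> (forall i, 0 < B i i) ->
  change_of_variables B /\ change_of_variables B^T.
Proof.
elim: n B => [|n IH] B Bt Bpos.
  have B1 (C : 'M[R]_0) : change_of_variables C.
    move=> b h mh h0; rewrite det_mx00 mul1e; apply: eq_integral => x _.
    by congr h; rewrite [RHS]tuple0 [LHS]tuple0.
  by split; exact: B1.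
move: B Bt Bpos; change n.+1 with (1 + n)%N => B Bt Bpos.
rewrite -[B]submxK is_trig_block_mx// in Bt.
case/and3P: Bt => /eqP B0 _ Bt.
pose r := B 0 0; pose w : 'cV[R]_n := dlsubmx B; pose C : 'M[R]_n := drsubmx B.
have BE : B = block_mx r%:M 0 w C.
  rewrite -[LHS]submxK B0; congr block_mx.
  by apply/matrixP => i j; rewrite !ord1 !mxE eqxx mulr1n /r; congr (B _ _);
    exact/val_inj.
have r0 : 0 < r by exact: Bpos.
have Cpos i : 0 < C i i by rewrite !mxE.
have [cC cCT] := IH C Bt Cpos.
have detC : 0 < \det C by rewrite det_trig// prodr_gt0.
have detB : \det B = r * \det C by rewrite BE det_lblock det_scalar1.
have mcons (t : R) : measurable_fun setT (fun x : n.-tuple R => tuple_cons (t, x)).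
  by apply: measurableT_comp; [exact: measurable_tuple_cons|].
have mcons' (x : n.-tuple R) : measurable_fun setT (fun t : R => tuple_cons (t, x)).
  by apply: measurableT_comp; [exact: measurable_tuple_cons|].
split => b h mh h0.
- have affE t x : affine_tuple B b (tuple_cons (t, x)) =
      tuple_cons (r * t + b 0 0,
        affine_tuple C (t *: w + dsubmx (b : 'cV_(1 + n))) x).
    rewrite /affine_tuple colvec_cons {1}BE mul_block_col mul0mx addr0.
    rewrite -[b in LHS](@vsubmxK _ 1 n) add_col_mx tuple_of_col_mx; congr tuple_cons.
    congr pair.
      rewrite -scalar_mxM !mxE eqxx mulr1n; congr (_ + b _ _); exact/val_inj.
    by congr tuple_of_col; rewrite mul_mx_scalar addrAC addrA addrC addrA addrAC.
  rewrite detB EFinM -muleA integral_tuple_cons//; last first.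
    by apply: measurableT_comp => //; exact: measurable_affine_tuple.
  pose H t := (\int[leb n]_x h (tuple_cons (t, x)))%E.
  have mH : measurable_fun setT H.
    apply: (measurable_fun_fubini_tonelli_F (h \o @tuple_cons R n)) => [|z];
      last exact: h0.
    by apply: measurableT_comp => //; exact: measurable_tuple_cons.
  rewrite (integral_tuple_cons mh h0) -/(H _).
  rewrite -(@ge0_integral_affine R r (b 0 0) H)//; last first.
    by move=> t; exact: integral_ge0.
  congr (_ * _)%E; rewrite -ge0_integralZl_EFin ?(ltW detC)//; last 2 first.
  + by move=> t _; exact: integral_ge0.
  + apply: (measurable_fun_fubini_tonelli_F (h \o affine_tuple B b \o @tuple_cons R n)) => [|z];
      last exact: h0.
    apply: measurableT_comp; last exact: measurable_tuple_cons.
    by apply: measurableT_comp => //; exact: measurable_affine_tuple.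
  apply: eq_integral => t _; rewrite /H -[RHS](cC (t *: w + dsubmx (b : 'cV_(1 + n)))
      (fun x => h (tuple_cons (r * t + b 0 0, x)))) => [|//|//].
    by congr (_ * _)%E; apply: eq_integral => x _; rewrite affE.
  exact: measurableT_comp.
- have affE t x : affine_tuple B^T b (tuple_cons (t, x)) =
      tuple_cons (r * t + ((w^T *m colvec x) 0 0 + b 0 0),
        affine_tuple C^T (dsubmx (b : 'cV_(1 + n))) x).
    rewrite /affine_tuple colvec_cons {1}BE tr_block_mx mul_block_col trmx0 mul0mx add0r.
    rewrite -[b in LHS](@vsubmxK _ 1 n) add_col_mx tuple_of_col_mx; congr tuple_cons.
    congr pair; rewrite tr_scalar_mx -scalar_mxM ![in LHS]mxE eqxx mulr1n -addrA.
    by congr (_ + (_ + b _ _)); [rewrite mxE|exact/val_inj].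
  rewrite det_tr detB mulrC EFinM -muleA integral_tuple_cons_sym//; last first.
    by apply: measurableT_comp => //; exact: measurable_affine_tuple.
  pose H x := (\int[@lebesgue_measure R]_t h (tuple_cons (t, x)))%E.
  have mH : measurable_fun setT H.
    apply: (measurable_fun_fubini_tonelli_G (m1 := @lebesgue_measure R) (h \o @tuple_cons R n)) => [|z];
      last exact: h0.
    by apply: measurableT_comp => //; exact: measurable_tuple_cons.
  rewrite (integral_tuple_cons_sym mh h0) -/(H _).
  rewrite -(cCT (dsubmx (b : 'cV_(1 + n))) H)//; last first.
    by move=> t; exact: integral_ge0.
  rewrite det_tr.
  congr (_ * _)%E; rewrite -ge0_integralZl_EFin ?(ltW r0)//; last 2 first.
  + by move=> t _; exact: integral_ge0.
  + apply: (measurable_fun_fubini_tonelli_G (m1 := @lebesgue_measure R) (h \o affine_tuple B^T b \o @tuple_cons R n)) => [|z];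
      last exact: h0.
    apply: measurableT_comp; last exact: measurable_tuple_cons.
    by apply: measurableT_comp => //; exact: measurable_affine_tuple.
  apply: eq_integral => x _; rewrite /H.
  rewrite -[RHS](ge0_integral_affine ((w^T *m colvec x) 0 0 + b 0 0)
    (h := fun t => h (tuple_cons (t, affine_tuple C^T (dsubmx (b : 'cV_(1 + n))) x))) r0) => [|//|//].
    by congr (_ * _)%E; apply: eq_integral => t _; rewrite affE.
  exact: measurableT_comp.
Qed.

Lemma change_of_variables_posdef n (M : 'M[R]_n) : M^T = M ->
  (forall x, x != 0 -> 0 < dot (M *m x) x) ->
  0 < \det M /\ change_of_variables M.
Proof.
move=> Msym Mpos; have [B [Bt Bpos -> _]] := cholesky Msym Mpos.
have [cB cBT] := change_of_variables_trig Bt Bpos; split.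
  by rewrite det_mulmx det_tr det_trig// mulr_gt0// prodr_gt0.
exact: change_of_variables_mul.
Qed.

Lemma measurable_expR_dot n :
  measurable_fun setT (fun x : n.-tuple R => expR (- dot (colvec x) (colvec x))).
Proof.
apply: measurableT_comp => //; apply: measurableT_comp => //.
by apply: measurable_sum => i; apply: measurable_funM; exact: measurable_colvec.
Qed.

Lemma integral_expR_dot n :
  (\int[leb n]_x (expR (- dot (colvec x) (colvec x)))%:E =
   (Num.sqrt pi ^+ n)%:E :> \bar R)%E.
Proof.
elim: n => [|n IH].
  under eq_integral do rewrite /dot big_ord0 oppr0 expR0.
  by rewrite integral_cst//= diracT mule1.
rewrite integral_tuple_cons//; last first.
  by apply/measurable_EFinP; exact: measurable_expR_dot.
have dotE' (t : R) (x : n.-tuple R) :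
    dot (colvec (tuple_cons (t, x))) (colvec (tuple_cons (t, x))) =
    t ^+ 2 + dot (colvec x) (colvec x).
  rewrite /dot big_ord_recl; congr (_ + _); first by rewrite mxE tnth0 expr2.
  by apply: eq_bigr => i _; rewrite !mxE tnthS.
under eq_integral => t _.
  under eq_integral do rewrite dotE' opprD expRD EFinM.
  rewrite ge0_integralZl_EFin ?expR_ge0//; last first.
    by apply/measurable_EFinP; exact: measurable_expR_dot.
  rewrite IH; over.
rewrite ge0_integralZr//=; last first.
  by apply/measurable_EFinP; exact: measurable_gauss_fun.
by rewrite integralT_gauss -EFinM exprS.
Qed.

Lemma measurable_expR_quadratic n (M : 'M[R]_n) :
  measurable_fun setT
    (fun x : n.-tuple R => expR (- dot (M *m colvec x) (colvec x))).
Proof.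
apply: measurableT_comp => //; apply: measurableT_comp => //.
apply: measurable_sum => i; apply: measurable_funM; last exact: measurable_colvec.
under eq_fun do rewrite mxE.
apply: measurable_sum => k; apply: measurable_funM => //.
exact: measurable_colvec.
Qed.

(** For M = B B^T the substitution x = B y turns <M^-1 x, x> into |y|^2. *)
Lemma integral_expR_invmx n (M : 'M[R]_n) : M^T = M ->
  (forall x, x != 0 -> 0 < dot (M *m x) x) ->
  (\int[leb n]_x (expR (- dot (invmx M *m colvec x) (colvec x)))%:E =
   (Num.sqrt (\det M) * Num.sqrt pi ^+ n)%:E :> \bar R)%E.
Proof.
move=> Msym Mpos; have [B [Bt Bpos ME _]] := cholesky Msym Mpos.
have [cB _] := change_of_variables_trig Bt Bpos.
have detB : 0 < \det B by rewrite det_trig// prodr_gt0.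
have Bu : B \in unitmx by rewrite unitmxE unitfE gt_eqF.
rewrite -(cB 0).
- have -> : Num.sqrt (\det M) = \det B.
    by rewrite ME det_mulmx det_tr -expr2 sqrtr_sqr ger0_norm// ltW.
  rewrite EFinM -integral_expR_dot; congr (_ * _)%E.
  apply: eq_integral => x _; congr (expR (- _))%:E.
  rewrite /affine_tuple tuple_of_colK addr0.
  have BTu : B^T \in unitmx by rewrite unitmx_tr.
  have Mu : M \in unitmx by rewrite ME unitmx_mul Bu.
  have BE : B *m colvec x = M *m (invmx B^T *m colvec x).
    by rewrite ME -mulmxA mulKVmx.
  by rewrite {1}BE mulKmx// -dot_trmx mulKVmx.
- by apply/measurable_EFinP; exact: measurable_expR_quadratic.
- by move=> x; rewrite lee_fin expR_ge0.
Qed.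

End affine_change_of_variables.

(** * Piecewise affine transport *)

Section piecewise_transport.
Context (R : realType) (n s : nat) (u : 'I_s -> 'cV[R]_n) (c : 'I_s -> R).
Hypothesis c_gt0 : forall j, 0 < c j.
Let A := weighted_frame u c.
Hypothesis A_ge1 : loewner_le 1%:M A.
Let kappa j := c j * dot (invmx A *m u j) (u j).
Local Notation leb := (borel_lebesgue R n).
Local Notation proj x j := (dot (colvec x) (u j)).

Lemma measurable_forall_dot (E : 'I_s -> set R) :
  (forall j, measurable (E j)) ->
  measurable [set x : n.-tuple R | forall j, E j (proj x j)].
Proof.
move=> mE.
rewrite (_ : [set _ | _] = \bigcap_(j in [set: 'I_s])
    ((fun x : n.-tuple R => proj x j) @^-1` E j)).
  apply: fin_bigcap_measurable => [|j _]; first exact: finite_finset.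
  by rewrite -[X in measurable X]setTI; exact: measurable_dot_colvec.
by apply/seteqP; split=> [x Ex j _|x Ex j]; [exact: Ex|exact: (Ex j)].
Qed.

Context (I : finType) (D : 'I_s -> set R) (cell : 'I_s -> R -> I).
Context (a b : 'I_s -> I -> R).
Let T j t := a j (cell j t) * t + b j (cell j t).
Hypothesis mcell : forall j i, measurable (D j `&` cell j @^-1` [set i]).
Hypothesis slope_gt0 : forall j t, D j t -> 0 < a j (cell j t).
Hypothesis T_incr :
  forall j t t', D j t -> D j t' -> t < t' -> T j t < T j t'.

(** [E p] is the cell of R^n on which every <x, u_j> lies in the piece [p j] of T_j; there Theta is
    the affine map with linear part [M p] and shift [v p]. The target density is [h], and [g p] is
    the density to be dominated. *)
Let E (p : {ffun 'I_s -> I}) : set (n.-tuple R) :=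
  [set x | forall j, (D j `&` cell j @^-1` [set p j]) (proj x j)].
Let M (p : {ffun 'I_s -> I}) := weighted_frame u (fun j => c j * a j (p j)).
Let v (p : {ffun 'I_s -> I}) := \sum_j (c j * b j (p j)) *: u j.
Let Theta p := affine_tuple (M p) (v p).
Let h (y : n.-tuple R) := expR (- dot (invmx A *m colvec y) (colvec y)).
Let g (p : {ffun 'I_s -> I}) (x : n.-tuple R) := \prod_j a j (p j) `^ kappa j *
  expR (- \sum_j c j * (a j (p j) * proj x j + b j (p j)) ^+ 2).

Let mE p : measurable (E p).
Proof.
pose F j := D j `&` cell j @^-1` [set p j].
by apply: (@measurable_forall_dot F) => j; exact: mcell.
Qed.

Let mh : measurable_fun setT h.
Proof. exact: measurable_expR_quadratic. Qed.

Let mg p : measurable_fun setT (g p).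
Proof.
apply: measurable_funM => //; apply: measurableT_comp => //.
apply: measurableT_comp => //; apply: measurable_sum => j.
apply: measurable_funM => //; apply: measurable_funX.
apply: measurable_funD => //; apply: measurable_funM => //.
exact: measurable_dot_colvec.
Qed.

Let colvec_Theta p x : colvec (Theta p x) =
  \sum_j (c j * (a j (p j) * proj x j + b j (p j))) *: u j.
Proof.
rewrite /Theta /affine_tuple tuple_of_colK mulmx_suml -big_split.
apply: eq_bigr => j _ /=.
by rewrite -scalemxAl tensorE scalerA -scalerDl (dotC (u j)) mulrDr mulrA.
Qed.

Let M_posdef p x0 : E p x0 -> 0 < \det (M p) /\ change_of_variables (M p).
Proof.
move=> Ex0; apply: change_of_variables_posdef.
  exact: weighted_frame_sym.
apply: weighted_frame_gt0 A_ge1 _ _ => j; apply: mulr_gt0 => //.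
by have [Dj /= <-] := Ex0 j; exact: slope_gt0.
Qed.

(** The inner product of Theta(x) - Theta(y) with x - y is a sum of terms that are nonnegative since
    the T_j increase, even across cells. If it is 0 then all projections agree, and A >= I makes
    them determine x. *)
Let Theta_inj p q x y : E p x -> E q y -> Theta p x = Theta q y -> p = q /\ x = y.
Proof.
move=> Ex Ey Txy.
have Tp j : T j (proj x j) = a j (p j) * proj x j + b j (p j).
  by have [_ /= <-] := Ex j.
have Tq j : T j (proj y j) = a j (q j) * proj y j + b j (q j).
  by have [_ /= <-] := Ey j.
have eq_proj j : proj x j = proj y j.
  have mono k : 0 <= c k * ((T k (proj x k) - T k (proj y k)) * (proj x k - proj y k)).
    apply: mulr_ge0; first exact: ltW.
    have [Dx _] := Ex k; have [Dy _] := Ey k.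
    case: (ltgtP (proj x k) (proj y k)) => [xy|yx|->].
    - by rewrite nmulr_rge0 ?subr_le0 ?subr_lt0 ?(ltW xy)// T_incr.
    - by rewrite mulr_ge0 ?subr_ge0 ?(ltW yx)// ltW// T_incr.
    - by rewrite !subrr mulr0.
  have : \sum_k c k * ((T k (proj x k) - T k (proj y k)) * (proj x k - proj y k)) = 0.
    transitivity (dot (colvec (Theta p x) - colvec (Theta q y)) (colvec x - colvec y)).
      rewrite !colvec_Theta -sumrB dot_suml; apply: eq_bigr => k _.
      rewrite -scalerBl dotZl -mulrBr -Tp -Tq -mulrA; congr (_ * (_ * _)).
      by rewrite dotBr !(dotC (u k)).
    by rewrite Txy subrr dot0l.
  move=> /eqP; rewrite psumr_eq0// => /allP/(_ j (mem_index_enum _)) /=.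
  rewrite !mulf_eq0 gt_eqF//= !subr_eq0 => /orP[|/eqP//].
  have [Dx _] := Ex j; have [Dy _] := Ey j.
  case: (ltgtP (proj x j) (proj y j)) => // [xy|yx].
  - by rewrite lt_eqF// T_incr.
  - by rewrite gt_eqF// T_incr.
split.
  apply/ffunP => j; have [_ /= <-] := Ex j; have [_ /= <-] := Ey j.
  by rewrite eq_proj.
apply: (can_inj (@colvecK R n)); apply/eqP; rewrite -subr_eq0 -dot_eq0.
rewrite eq_le dot_ge0 andbT -{1}(mul1mx (_ - _)).
apply: (le_trans (A_ge1 _)); rewrite dot_weighted_frame big1// => j _.
by rewrite (dotC (u j)) dotBl eq_proj subrr mulr0.
Qed.

(** The image is the preimage of the cell under the inverse affine map. *)
Let mTheta p : measurable (Theta p @` E p).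
Proof.
have [->|/set0P[x0 Ex0]] := eqVneq (E p) set0; first by rewrite image_set0.
have [detM _] := M_posdef Ex0.
have Mu : M p \in unitmx by rewrite unitmxE unitfE gt_eqF.
pose inv := affine_tuple (invmx (M p)) (- (invmx (M p) *m v p)).
have ThetaK : cancel (Theta p) inv.
  move=> x; apply: (can_inj (@colvecK R n)).
  by rewrite /inv /Theta /affine_tuple !tuple_of_colK mulmxDr addrK mulKmx.
have invK : cancel inv (Theta p).
  move=> x; apply: (can_inj (@colvecK R n)).
  rewrite /inv /Theta /affine_tuple !tuple_of_colK mulmxDr mulmxN.
  by rewrite !mulKVmx// subrK.
rewrite (_ : _ @` _ = inv @^-1` E p); last first.
  apply/seteqP; split => [_ [x Ex <-]|y Ey] /=; first by rewrite ThetaK.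
  by exists (inv y).
rewrite -[X in measurable X]setTI.
exact: measurable_affine_tuple.
Qed.

(** On a nonempty cell, the determinant inequality and [dot_invmx_frame_sum] bound [g p] by (det
    A)^-1 det(M p) times [h] composed with Theta; the affine change of variables absorbs det(M
    p). *)
Let cell_le p :
  (\int[leb]_x (\1_(E p) x * g p x)%:E <=
   (\det A)^-1%:E * \int[leb]_y (\1_(Theta p @` E p) y * h y)%:E)%E.
Proof.
have [E0|/set0P[x0 Ex0]] := eqVneq (E p) set0.
  rewrite E0 image_set0 indic0.
  by under eq_integral do rewrite mul0r; rewrite !integral0_eq// ?mule0// => y _;
    rewrite mul0r.
have [detM cv] := M_posdef Ex0.
have detA : 0 < \det A by exact: lt_le_trans (det_frame_ge1 c_gt0 A_ge1).
have apos j : 0 < a j (p j).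
  by have [Dj /= <-] := Ex0 j; exact: slope_gt0.
have mIh : measurable_fun setT (fun y => (\1_(Theta p @` E p) y * h y)%:E).
  apply/measurable_EFinP; exact: measurable_funM.
have Ih0 y : (0 <= (\1_(Theta p @` E p) y * h y)%:E)%E.
  by rewrite lee_fin mulr_ge0// expR_ge0.
have mTh : measurable_fun setT (Theta p) by exact: measurable_affine_tuple.
rewrite -[X in (_ <= _ * X)%E](cv (v p))// -ge0_integralZl_EFin ?(ltW detM)//; last first.
  exact: measurableT_comp mIh mTh.
rewrite -ge0_integralZl_EFin ?invr_ge0 ?(ltW detA)//; last 2 first.
- by move=> x _; rewrite mule_ge0// lee_fin ltW.
- apply: measurable_funeM; exact: measurableT_comp mIh mTh.
apply: ge0_le_integral => //.
- by move=> x _; rewrite lee_fin mulr_ge0// mulr_ge0 ?expR_ge0// prodr_ge0// => j _; exact: powR_ge0.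
- by apply/measurable_EFinP; exact: measurable_funM.
- apply: measurable_funeM; apply: measurable_funeM; exact: measurableT_comp mIh mTh.
move=> x _; rewrite -!EFinM lee_fin -/(Theta p x).
have [Ex|nEx] := pselect (E p x); last first.
  rewrite indicE memNset// mul0r mulr_ge0 ?invr_ge0 ?(ltW detA)//.
  by rewrite mulr_ge0 ?(ltW detM)// mulr_ge0// expR_ge0.
rewrite !indicE !mem_set//.
rewrite !mul1r /g /h mulrA colvec_Theta; apply: ler_pM.
- by apply: prodr_ge0 => j _; exact: powR_ge0.
- exact: expR_ge0.
- rewrite ler_pdivlMl//; exact: det_weighted_frame_ge.
- by rewrite ler_expR lerN2; exact: dot_invmx_frame_sum.
Qed.

Let F x := \1_[set x | forall j, D j (proj x j)] x *
  (\prod_j a j (cell j (proj x j)) `^ kappa j *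
   expR (- \sum_j c j * T j (proj x j) ^+ 2)).

Let F_cells x : F x = \sum_p \1_(E p) x * g p x.
Proof.
rewrite /F.
have [Dx|nDx] := pselect (forall j, D j (proj x j)); last first.
  rewrite indicE memNset// mul0r big1// => p _.
  by rewrite indicE memNset ?mul0r// => Ex; apply: nDx => j; case: (Ex j).
rewrite indicE mem_set// mul1r (bigD1 [ffun j => cell j (proj x j)])//=.
rewrite [X in _ + X]big1 ?addr0; last first.
  move=> p pc; rewrite indicE memNset ?mul0r// => Ex.
  move/eqP : pc; apply; apply/ffunP => j; rewrite ffunE.
  by have [_ /= <-] := Ex j.
rewrite indicE mem_set ?mul1r; last by move=> j; split; [exact: Dx|rewrite /= ffunE].
rewrite /g; congr (_ * expR (- _)); apply: eq_bigr => j _; rewrite ffunE//.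
Qed.

Lemma measurable_piecewise_transport : measurable_fun setT F.
Proof.
rewrite (_ : F = fun x => \sum_p \1_(E p) x * g p x); last exact/funext.
by apply: measurable_sum => p; exact: measurable_funM.
Qed.

(* [Theta] is strictly monotone because each [T j] is increasing, so the images
   of the cells are disjoint and their Gaussian integrals add up to at most
   the full one. *)
Lemma piecewise_transport_le :
  (\int[leb]_x (\1_[set x | forall j, D j (proj x j)] x *
     (\prod_j a j (cell j (proj x j)) `^ kappa j *
      expR (- \sum_j c j * T j (proj x j) ^+ 2)))%:E <=
   (\det A)^-1%:E *
   \int[leb]_y (expR (- dot (invmx A *m colvec y) (colvec y)))%:E)%E.
Proof.
have detA : 0 < \det A by exact: lt_le_trans (det_frame_ge1 c_gt0 A_ge1).
have g0 p x : 0 <= g p x.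
  by rewrite mulr_ge0 ?expR_ge0// prodr_ge0// => j _; exact: powR_ge0.
under eq_integral => x _.
  rewrite -/(F x) F_cells -sumEFin; over.
rewrite ge0_integral_sum//; last 2 first.
- by move=> p; apply/measurable_EFinP; exact: measurable_funM.
- by move=> p x _; rewrite lee_fin mulr_ge0.
apply: (@le_trans _ _ (\sum_p (\det A)^-1%:E *
    \int[leb]_y (\1_(Theta p @` E p) y * h y)%:E)%E).
  by apply: lee_sum => p _; exact: cell_le.
rewrite -ge0_sume_distrr; last first.
  by move=> p _; apply: integral_ge0 => y _; rewrite lee_fin mulr_ge0// expR_ge0.
apply: lee_wpmul2l; first by rewrite lee_fin invr_ge0 ltW.
rewrite -ge0_integral_sum//; last 2 first.
- by move=> p; apply/measurable_EFinP; exact: measurable_funM.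
- by move=> p x _; rewrite lee_fin mulr_ge0// expR_ge0.
apply: ge0_le_integral => //.
- by move=> x _; apply: sume_ge0 => p _; rewrite lee_fin mulr_ge0// expR_ge0.
- apply: emeasurable_sum => p; apply/measurable_EFinP; exact: measurable_funM.
- by apply/measurable_EFinP.
move=> y _; rewrite sumEFin lee_fin -mulr_suml -[leRHS]mul1r ler_wpM2r ?expR_ge0//.
have [[p Ep]|nE] := pselect (exists p, (Theta p @` E p) y); last first.
  rewrite big1 ?ler01// => p _; rewrite indicE memNset// => Ep; apply: nE.
  by exists p.
rewrite (bigD1 p)//= big1 ?addr0 ?indicE; first by rewrite mem_set.
move=> q qp; rewrite indicE memNset// => -[x Eqx Txy].
case: Ep => z Epz Tzy; move/eqP : qp; apply.
by have [] := Theta_inj Eqx Epz (etrans Txy (esym Tzy)).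
Qed.

End piecewise_transport.

(** * Piecewise affine quantile functions for the Gaussian *)

Section gaussian_quantile.
Context (R : realType).
Local Notation mu := (@lebesgue_measure R).
Local Notation g := (@gauss_fun R).

(* [Q] is piecewise affine on the interval from 0 to [M], below [y], and steep
   enough to push Lebesgue measure there to a measure of density at most [g]. *)
Definition gauss_quantile (I : finType) (cell : R -> I) (a b : I -> R) (M y : R) :=
  let Q t := a (cell t) * t + b (cell t) in
  [/\ forall i, measurable (`]0, M] `&` cell @^-1` [set i]),
      forall t, 0 < t <= M -> 0 < a (cell t) /\ 1 <= a (cell t) * g (Q t),
      forall t t', 0 < t -> t < t' -> t' <= M -> Q t < Q t' &
      forall t, 0 < t <= M -> Q t <= y].

Definition has_gauss_quantile (M y : R) :=
  0 <= M /\ exists (I : finType) (cell : R -> I) (a b : I -> R),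
    gauss_quantile cell a b M y.

(** The domain is empty, so the construction may start at any height [y]. *)
Lemma has_gauss_quantile0 y : has_gauss_quantile 0 y.
Proof.
split=> //; exists unit, (fun=> tt), (fun=> 0), (fun=> 0); split.
- by move=> i; rewrite set_itvoc0 set0I.
- by move=> t /andP[t0 /(lt_le_trans t0)]; rewrite ltxx.
- by move=> t t' t0 tt' t'0; have := lt_le_trans (lt_trans t0 tt') t'0; rewrite ltxx.
- by move=> t /andP[t0 /(lt_le_trans t0)]; rewrite ltxx.
Qed.

(** A piece of slope 1/d is appended over an interval of length h d, where it climbs from [y] to
    [y + h]; the density is at least [d] along the way. *)
Lemma has_gauss_quantileD M y h d : 0 < d -> 0 < h ->
  (forall z, y <= z <= y + h -> d <= g z) ->
  has_gauss_quantile M y -> has_gauss_quantile (M + h * d) (y + h).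
Proof.
move=> d0 h0 dg [M0 [I [cell [a [b [mcell slope incr bound]]]]]].
split; first by rewrite addr_ge0// mulr_ge0// ltW.
pose cell' t := if t <= M then Some (cell t) else None.
pose a' i := if i is Some j then a j else d^-1.
pose b' i := if i is Some j then b j else y - M / d.
exists (option I), cell', a', b'.
have QS t : t <= M -> a' (cell' t) * t + b' (cell' t) = a (cell t) * t + b (cell t).
  by rewrite /cell' => ->.
have cellN t : M < t -> cell' t = None by rewrite /cell' ltNge => /negPf ->.
have QN t : M < t -> a' (cell' t) * t + b' (cell' t) = y + (t - M) / d.
  by move=> Mt; rewrite cellN//=; field; rewrite gt_eqF.
have QNle t : t <= M + h * d -> y + (t - M) / d <= y + h.
  by move=> th; rewrite lerD2l ler_pdivrMr// lerBlDl.
split => /=.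
- move=> [i|].
    rewrite (_ : _ `&` _ = `]0, M] `&` cell @^-1` [set i])//.
    apply/seteqP; split => t /=; rewrite !in_itv/= /cell' => -[/andP[t0 tM]].
      by case: ifPn => // tM' [<-]; rewrite t0.
    by rewrite tM t0 => ->; split => //=; rewrite (le_trans tM)// lerDl mulr_ge0// ltW.
  rewrite (_ : _ `&` _ = `]M, (M + h * d)]%classic)//.
  apply/seteqP; split => t /=; rewrite !in_itv/=.
    by move=> [/andP[_ ->]]; rewrite andbT /cell'; case: (leP t M).
  by move=> /andP[Mt ->]; rewrite (le_lt_trans M0 Mt) cellN.
- move=> t /andP[t0 tM]; have [tM'|Mt] := leP t M.
    by rewrite QS// /cell' tM'/=; apply: slope; rewrite t0.
  rewrite QN// cellN//= invr_gt0; split => //.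
  rewrite ler_pdivlMl// mulr1; apply: dg.
  by rewrite QNle// andbT lerDl divr_ge0 ?subr_ge0 ?(ltW Mt) ?(ltW d0).
- move=> t t' t0 tt' t'M; have [tM|Mt] := leP t M; last first.
    rewrite (QN t)// (QN t') ?(lt_trans Mt)// ltrD2l ltr_pM2r ?invr_gt0//.
    by rewrite ltrD2r.
  have [t'M'|Mt'] := leP t' M; first by rewrite !QS//; exact: incr.
  rewrite QS// QN//; apply: (@le_lt_trans _ _ y); first by apply: bound; rewrite t0.
  by rewrite ltrDl divr_gt0// subr_gt0.
- move=> t /andP[t0 tM]; have [tM'|Mt] := leP t M.
    by rewrite QS//; apply: le_trans (bound _ _) _; rewrite ?t0// lerDl ltW.
  by rewrite QN// QNle.
Qed.

Lemma has_gauss_quantileW M M' y : 0 <= M' -> M' <= M ->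
  has_gauss_quantile M y -> has_gauss_quantile M' y.
Proof.
move=> M'0 M'M [M0 [I [cell [a [b [mcell slope incr bound]]]]]].
split => //; exists I, cell, a, b.
have tM t : 0 < t <= M' -> 0 < t <= M.
  by move=> /andP[-> /le_trans]; exact.
split.
- move=> i; rewrite (_ : _ `&` _ = `]0, M'] `&` (`]0, M] `&` cell @^-1` [set i])).
    exact: measurableI.
  rewrite setIA; congr (_ `&` _); apply/seteqP; split => t /=; last by case.
  by rewrite !in_itv/= => tM'; split => //; exact: tM.
- by move=> t /tM; exact: slope.
- by move=> t t' t0 tt' /le_trans t'M; apply: incr => //; exact: t'M.
- by move=> t /tM; exact: bound.
Qed.

Lemma gauss_fun_le (x y : R) : `|x| <= `|y| -> g y <= g x.
Proof.
by move=> xy; rewrite ler_expR lerN2 -(real_normK (num_real x))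
  -(real_normK (num_real y)) ler_sqr ?nnegrE.
Qed.

(** The function climbs from -kh to 0 in k steps of height h. On each step the Gaussian is smallest
    at the end farther from 0, whence the terms of a lower Riemann sum. *)
Lemma has_gauss_quantile_left h k M : 0 < h ->
  has_gauss_quantile M (- (k%:R * h)) ->
  has_gauss_quantile (M + \sum_(i < k) h * g (i.+1%:R * h)) 0.
Proof.
move=> h0; elim: k M => [|k IH] M; first by rewrite mul0r oppr0 big_ord0 addr0.
move=> PM; rewrite big_ord_recr/= addrA addrAC; apply: IH.
rewrite (_ : - _ = - (k.+1%:R * h) + h); last by rewrite -natr1; ring.
apply: has_gauss_quantileD PM => //; first exact: expR_gt0.
move=> z /andP[yz zh]; apply: gauss_fun_le.
have kh0 i : 0 <= i%:R * h by rewrite mulr_ge0// ltW.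
rewrite [in leRHS]ger0_norm// ler_norml yz /= (le_trans zh)//.
rewrite (@le_trans _ _ 0)//.
by rewrite addrC subr_le0 -[leLHS]mul1r ler_pM2r// ler1n.
Qed.

Lemma has_gauss_quantile_right h k M : 0 < h ->
  has_gauss_quantile M 0 ->
  has_gauss_quantile (M + \sum_(i < k) h * g (i.+1%:R * h)) (k%:R * h).
Proof.
move=> h0 PM; elim: k => [|k IH]; first by rewrite mul0r big_ord0 addr0.
rewrite big_ord_recr/= addrA -[in X in has_gauss_quantile _ X]natr1 mulrDl mul1r.
apply: has_gauss_quantileD IH => //; first exact: expR_gt0.
move=> z /andP[yz zh]; apply: gauss_fun_le.
rewrite !ger0_norm ?mulr_ge0 ?(ltW h0)//; first by rewrite -natr1 mulrDl mul1r.
by apply: le_trans yz; rewrite mulr_ge0// ltW.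
Qed.

(** The Gaussian decreases on the half-line, so left endpoints give an upper sum. It exceeds the
    lower sum over right endpoints by at most [h]. *)
Lemma gauss_upper_sum h k : 0 < h ->
  (\int[mu]_(x in `[0%R, (k%:R * h)%R]) (g x)%:E <=
   (\sum_(i < k) h * g (i%:R * h))%:E)%E.
Proof.
move=> h0; elim: k => [|k IH].
  by rewrite mul0r set_itv1 integral_set1 big_ord0.
have kh0 : 0 <= k%:R * h by rewrite mulr_ge0// ltW.
have kS : k.+1%:R * h = k%:R * h + h by rewrite -natr1 mulrDl mul1r.
have mg D : measurable_fun D (EFin \o g).
  by apply/measurable_EFinP/measurable_funTS; exact: measurable_gauss_fun.
rewrite (_ : `[0, _]%classic = `[0, k%:R * h]%classic `|`
    `](k%:R * h), (k.+1%:R * h)]%classic); last first.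
  apply/seteqP; split => t /=; rewrite !in_itv/=.
    by move=> /andP[-> ->]; case: leP; [left|right].
  move=> [/andP[-> tk]|/andP[kt ->]]/=; last by rewrite (le_trans kh0 (ltW kt)).
  by rewrite (le_trans tk)// kS lerDl ltW.
have disj : [disjoint `[0, k%:R * h]%classic &
    `](k%:R * h), (k.+1%:R * h)]%classic].
  rewrite disj_set2E; apply/eqP/seteqP; split => // t [] /=; rewrite !in_itv/=.
  by move=> /andP[_ tk] /andP[/(le_lt_trans tk)]; rewrite ltxx.
rewrite ge0_integral_setU//; [|exact: mg|by move=> x _; rewrite lee_fin expR_ge0].
rewrite big_ord_recr/= EFinD; apply: leeD => //.
apply: (@le_trans _ _ (\int[mu]_(x in `](k%:R * h)%R, (k.+1%:R * h)%R])
    (g (k%:R * h)%R)%:E)%E).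
  apply: ge0_le_integral; [by []|by move=> x _; rewrite lee_fin expR_ge0|exact: mg|exact: measurable_cst|].
  move=> x /=; rewrite in_itv/= => /andP[kx _]; rewrite lee_fin gauss_fun_le//.
  by rewrite !ger0_norm ?(ltW kx)// (le_trans kh0 (ltW kx)).
rewrite integral_cst//= lebesgue_measure_itv/= lte_fin kS ltrDl h0.
by rewrite -EFinD addrAC subrr add0r -EFinM lee_fin mulrC.
Qed.

(** By symmetry a lower sum of M/2 = sqrt(pi)/2 - e/2 on the half-line is enough; the cut at N and
    the mesh [h] cost at most e/4 each. *)
Lemma gauss_quantile_exists (M : R) : 0 <= M -> M < Num.sqrt pi ->
  exists (I : finType) (cell : R -> I) (a b : I -> R) (y : R),
    gauss_quantile cell a b M y.
Proof.
move=> M0 Mpi; pose e := Num.sqrt pi - M; have e0 : 0 < e by rewrite subr_gt0.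
have [q qe] : exists q : nat, q.+1%:R^-1 < e / 4.
  have e4 : 0 < e / 4 by rewrite divr_gt0.
  have [q _ qe] := near_infty_natSinv_lt (PosNum e4).
  by exists q; exact: (qe q (leqnn q)).
pose h := q.+1%:R^-1 : R; have h0 : 0 < h by rewrite invr_gt0.
have [N Nint] : exists N : nat, ((Num.sqrt pi / 2 - e / 4)%:E <=
    \int[mu]_(x in `[0%R, N%:R]) (g x)%:E)%E.
  have := @ge0_cvgn_integral R mu g (@gauss_fun_ge0 R) (@measurable_gauss_fun R).
  rewrite integral0y_gauss => cvgI.
  have /cvgI[N _ HN] : nbhs (Num.sqrt pi / 2)%:E [set x | ((Num.sqrt pi / 2 - e / 4)%:E < x)%E].
    apply: open_nbhs_nbhs; split; first exact: open_ereal_gt_ereal.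
    by rewrite /= lte_fin ltrBlDr ltrDl divr_gt0.
  by exists N; apply/ltW; exact: (HN N (leqnn N)).
pose k := (N * q.+1)%N; have kh : k%:R * h = N%:R :> R.
  by rewrite /k /h natrM -mulrA divff ?mulr1// pnatr_eq0.
have := le_trans Nint; rewrite -kh => /(_ _ (gauss_upper_sum k h0)).
rewrite lee_fin => lower.
pose S := \sum_(i < k) h * g (i.+1%:R * h).
have S_ge : M / 2 <= S.
  have : \sum_(i < k) h * g (i%:R * h) <= S + h.
    have eqS : \sum_(i < k.+1) h * g (i%:R * h) = S + h * g 0.
      by rewrite big_ord_recl mul0r addrC.
    have : \sum_(i < k) h * g (i%:R * h) <= \sum_(i < k.+1) h * g (i%:R * h).
      by rewrite big_ord_recr/= lerDl mulr_ge0 ?(ltW h0)// gauss_fun_ge0.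
    move/le_trans; apply; rewrite eqS lerD2l -[leRHS]mulr1.
    by rewrite ler_pM2l// gauss_fun_le1.
  move=> /(le_trans lower); move: qe; rewrite -/h /e; lra.
have P0 := has_gauss_quantile0 (- (k%:R * h)).
have P1 := has_gauss_quantile_right k h0 (has_gauss_quantile_left h0 P0).
have [] : has_gauss_quantile M (k%:R * h).
  apply: has_gauss_quantileW P1 => //; rewrite add0r -/S.
  by rewrite (splitr M) lerD.
by move=> _ [I [cell [a [b H]]]]; exists I, cell, a, b, (k%:R * h).
Qed.

End gaussian_quantile.

(** * Transport of step functions to the Gaussian *)

Section step_functions.
Context (R : realType) (L : finType).
Implicit Types (d : R) (l r : L -> R).

(** The intervals come from coverings and may overlap, in which case their contributions add up. *)
Definition step_fun d l r (t : R) := d * \sum_k (l k < t <= r k)%R%:R.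

Definition step_mass d l r := d * \sum_k (r k - l k).

Lemma measurable_step_fun d l r : measurable_fun setT (step_fun d l r).
Proof.
apply: measurable_funM => //; apply: measurable_sum => k.
rewrite (_ : (fun t => _) = \1_(`]l k, r k]%classic)); first exact: measurable_indic.
by apply/funext => t; rewrite indicE mem_setE in_itv.
Qed.

Variables (d : R) (l r : L -> R).
Hypothesis d_gt0 : 0 < d.
Hypothesis lr : forall k, l k <= r k.
Local Notation F := (step_fun d l r).
Local Notation S := (step_mass d l r).

Lemma step_fun_ge0 t : 0 <= F t.
Proof. by rewrite mulr_ge0 ?(ltW d_gt0)// sumr_ge0. Qed.

Lemma step_mass_ge0 : 0 <= S.
Proof.
by rewrite mulr_ge0 ?(ltW d_gt0)// sumr_ge0// => k _; rewrite subr_ge0.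
Qed.

(** The length of []l k, r k]] to the left of [t], so that [prim] is the primitive of
    [step_fun d l r]. *)
Let part k (t : R) :=
  if l k < t then if t <= r k then t - l k else r k - l k else 0.
Let prim t := d * \sum_k part k t.

Let part_ge0 k t : 0 <= part k t.
Proof.
rewrite /part; case: ltP => // lt; have lr' := lr k.
by case: ifP => _; rewrite subr_ge0// ltW.
Qed.

Let part_le k t : part k t <= r k - l k.
Proof.
rewrite /part; case: (ltP (l k) t) => [_|_]; last by rewrite subr_ge0.
by case: (leP t (r k)) => // tr; rewrite lerD2r.
Qed.

Let part_homo k t t' : t <= t' -> part k t <= part k t'.
Proof.
move=> tt'; have := lr k; rewrite /part.
case: (ltP (l k) t) => lt; case: (ltP (l k) t') => lt';
  case: (leP t (r k)) => tr; case: (leP t' (r k)) => t'r; lra.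
Qed.

Let F_gt0 t : 0 < F t -> exists k, l k < t <= r k.
Proof.
rewrite pmulr_rgt0// => F0; apply/existsP; apply: contraTT F0 => /existsPn nk.
by rewrite big1 ?ltxx// => k _; rewrite (negPf (nk k)).
Qed.

(** An interval containing [t'] is open on the left, so it has positive length between [t] and [t'],
    even when it starts after [t]. *)
Let prim_incr t t' : t < t' -> 0 < F t' -> prim t < prim t'.
Proof.
move=> tt' /F_gt0[k /andP[lt tr]]; rewrite ltr_pM2l//.
rewrite (bigD1 k)//= [ltRHS](bigD1 k)//=; apply: ltr_leD; last first.
  by apply: ler_sum => i _; apply: part_homo; exact: ltW.
rewrite /part lt tr; case: (ltP (l k) t) => _; last by rewrite subr_gt0.
by rewrite (le_trans (ltW tt') tr) ltrD2r.
Qed.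

Let prim_gt0 t : 0 < F t -> 0 < prim t.
Proof.
move=> /F_gt0[k /andP[lt tr]]; rewrite mulr_gt0// (bigD1 k)//=.
apply: ltr_pwDl; last by apply: sumr_ge0 => i _; exact: part_ge0.
by rewrite /part lt tr subr_gt0.
Qed.

Let prim_le t : prim t <= S.
Proof. by rewrite ler_pM2l// ler_sum. Qed.

(** The position of [t] relative to all endpoints. Where it is constant, [prim] is affine with slope
    [ps] and intercept [pc]. *)
Let sig (t : R) : {ffun L -> bool * bool} := [ffun k => (l k < t, t <= r k)].
Let ps (p : {ffun L -> bool * bool}) : R := d * \sum_k ((p k).1 && (p k).2)%:R.
Let pc (p : {ffun L -> bool * bool}) : R := d * \sum_k
  (if (p k).1 then if (p k).2 then - l k else r k - l k else 0).

Let psE t : ps (sig t) = F t.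
Proof. by congr (_ * _); apply: eq_bigr => k _; rewrite ffunE. Qed.

Let primE t : prim t = ps (sig t) * t + pc (sig t).
Proof.
rewrite /prim /ps /pc -mulrA -mulrDr mulr_suml -big_split; congr (_ * _).
apply: eq_bigr => k _; rewrite !ffunE /part /=.
by case: (l k < t); case: (t <= r k) => /=; rewrite ?mul1r ?mul0r ?add0r.
Qed.

Let measurable_sig p : measurable [set t : R | sig t = p].
Proof.
rewrite (_ : [set _ | _] = \bigcap_(k in [set: L])
    ([set t | (l k < t) = (p k).1] `&` [set t | (t <= r k) = (p k).2])).
  apply: fin_bigcap_measurable => [|k _]; first exact: finite_finset.
  have mlt : measurable_fun setT (fun t : R => l k < t) by exact: measurable_fun_ltr.
  have mle : measurable_fun setT (fun t : R => t <= r k) by exact: measurable_fun_ler.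
  apply: measurableI; rewrite -[X in measurable X]setTI.
    exact: (mlt measurableT [set (p k).1]).
  exact: (mle measurableT [set (p k).2]).
apply/seteqP; split => t /=.
  by move=> <- k _; rewrite ffunE.
by move=> tp; apply/ffunP => k; rewrite ffunE; have [/= -> ->] := tp k I; case: (p k).
Qed.

(* [T] is [rho * Q], with [Q] as in [gauss_quantile], composed with the
   primitive of [F] rescaled to take values in the domain of [Q]. *)
Lemma step_transport (I : finType) (cell : R -> I) (a b : I -> R) (M y rho : R) :
  0 < M -> 0 < rho -> gauss_quantile cell a b M y ->
  exists (cell' : R -> {ffun L -> bool * bool} * I)
         (a' b' : {ffun L -> bool * bool} * I -> R),
    let T t := a' (cell' t) * t + b' (cell' t) in
    [/\ forall i, measurable ([set t | 0 < F t] `&` cell' @^-1` [set i]),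
        forall t, 0 < F t -> 0 < a' (cell' t),
        forall t t', 0 < F t -> 0 < F t' -> t < t' -> T t < T t' &
        forall t, 0 < F t ->
          F t * (M * rho) <= S * (a' (cell' t) * expR (- (T t / rho) ^+ 2))].
Proof.
move=> M0 rho0 [mcell slope incr bound].
pose lam := M / S.
exists (fun t => (sig t, cell (lam * prim t))).
exists (fun i => rho * (a i.2 * (lam * ps i.1))).
exists (fun i => rho * (a i.2 * (lam * pc i.1) + b i.2)) => /=.
have TE t : rho * (a (cell (lam * prim t)) * (lam * ps (sig t))) * t +
    rho * (a (cell (lam * prim t)) * (lam * pc (sig t)) + b (cell (lam * prim t))) =
    rho * (a (cell (lam * prim t)) * (lam * prim t) + b (cell (lam * prim t))).
  by move: (cell _) => i; rewrite primE; ring.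
have S0 t : 0 < F t -> 0 < S by move=> /prim_gt0 /lt_le_trans; exact.
have lam0 t : 0 < F t -> 0 < lam by move=> /S0 S0'; rewrite divr_gt0.
have dom t : 0 < F t -> 0 < lam * prim t <= M.
  move=> Ft; rewrite mulr_gt0 ?(lam0 t) ?prim_gt0//= /lam mulrAC.
  by rewrite ler_pdivrMr ?(S0 t)// ler_pM2l.
split.
- move=> [p i].
  pose E := `]0, M] `&` cell @^-1` [set i].
  pose f t := lam * (ps p * t + pc p).
  rewrite (_ : _ `&` _ =
      [set t | 0 < F t] `&` ([set t | sig t = p] `&` f @^-1` E)).
    apply: measurableI.
      rewrite -[X in measurable X]setTI.
      have mF : measurable_fun setT (fun t : R => 0 < F t).
        by apply: measurable_fun_ltr => //; exact: measurable_step_fun.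
      exact: (mF measurableT [set true]).
    apply: measurableI => //; rewrite -[X in measurable X]setTI.
    have mf : measurable_fun setT f.
      by apply: measurable_funM => //; exact: measurable_affine.
    by apply: mf => //; exact: mcell.
  apply/seteqP; split => t /= [Ft].
    move=> [sp ci]; split => //; split => //; rewrite /E /f -sp -primE.
    by split; [rewrite /= in_itv/=; exact: dom|].
  by move=> [sp]; rewrite /E /f -sp -primE => -[_ /= ->]; split.
- move=> t Ft; have [a0 _] := slope _ (dom t Ft).
  by rewrite mulr_gt0// mulr_gt0// mulr_gt0 ?(lam0 t)// psE.
- move=> t t' Ft Ft' tt'; rewrite !TE ltr_pM2l//; apply: incr.
  + by case/andP: (dom t Ft).
  + by rewrite ltr_pM2l ?(lam0 t)//; exact: prim_incr.
  + by case/andP: (dom t' Ft').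
(* The slope of T at [t] is rho a lam F(t), with lam = M / S; the claim is this together with a g(Q)
   >= 1. *)
- move=> t Ft; rewrite TE psE; have [a0 ag] := slope _ (dom t Ft).
  rewrite [rho * (_ + _) / rho]mulrAC divff ?gt_eqF// mul1r.
  have -> : F t * (M * rho) = S * (rho * lam * F t).
    by rewrite /lam; field; rewrite gt_eqF// (S0 t).
  rewrite ler_pM2l ?(S0 t)// -[leLHS]mulr1.
  move: ag; rewrite /gauss_fun; set e := expR _; set ai := a _ => ag.
  rewrite [leRHS](_ : _ = rho * lam * F t * (ai * e)); last by ring.
  by rewrite ler_pM2l// mulr_gt0// mulr_gt0 ?(lam0 t).
Qed.

End step_functions.

(** Continuity of the product at t = 0. It serves both to let theta tend to 1 and to absorb
    approximation errors in the integrals. *)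
Lemma prodr_addr_le (R : realType) (I : Type) (s : seq I) (a : I -> R) (e : R) :
  (forall i, 0 <= a i) -> 0 < e ->
  exists2 t, 0 < t & \prod_(i <- s) (a i + t) <= \prod_(i <- s) a i + e.
Proof.
move=> a0; elim: s e => [|i s IH] e e0.
  by exists 1 => //; rewrite !big_nil lerDl ltW.
have ai1 : 0 < a i + 1 by rewrite ltr_wpDl.
have e2 : 0 < e / 2 by rewrite divr_gt0.
have [t t0 Ht] := IH (e / 2 / (a i + 1)) (divr_gt0 e2 ai1).
pose P := \prod_(j <- s) a j.
have P0 : 0 <= P by rewrite prodr_ge0.
have mono t' : 0 < t' -> t' <= t -> \prod_(j <- s) (a j + t') <= P + e / 2 / (a i + 1).
  move=> t'0 t't; apply: le_trans Ht; apply: ler_prod => j _.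
  by rewrite addr_ge0 ?(ltW t'0)//= lerD2l.
(* The three bounds keep the induction hypothesis, give a_i + t' <= a_i + 1, and give t' P <= e/2,
   also when P = 0. *)
pose t' := Num.min t (Num.min 1 (e / 2 / (P + 1))).
have P1 : 0 < P + 1 by rewrite ltr_wpDl.
have t'0 : 0 < t' by rewrite !lt_min t0 ltr01 !divr_gt0.
have t't : t' <= t by rewrite ge_min lexx.
have t'1 : t' <= 1 by rewrite !ge_min lexx !orbT.
have t'P : t' * P <= e / 2.
  apply: (@le_trans _ _ (t' * (P + 1))); first by rewrite ler_pM2l// lerDl.
  by rewrite -ler_pdivlMr// !ge_min lexx !orbT.
exists t' => //; rewrite !big_cons -/P.
apply: (@le_trans _ _ ((a i + t') * (P + e / 2 / (a i + 1)))).
  by rewrite ler_wpM2l ?addr_ge0 ?(ltW t'0)// mono.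
rewrite mulrDr mulrDl -addrA lerD2l.
rewrite [leRHS](splitr e) lerD// mulrA ler_pdivrMr// mulrC ler_pM2l ?divr_gt0//.
by rewrite lerD2l.
Qed.

(** * The inequality for step functions *)

Section step_brascamp_lieb.
Context (R : realType) (n s : nat) (gamma : R) (u : 'I_s -> 'cV[R]_n) (c : 'I_s -> R).
Hypothesis gamma_gt0 : 0 < gamma.
Hypothesis u1 : forall j, dot (u j) (u j) = 1.
Hypothesis c_gt0 : forall j, 0 < c j.
Let A := weighted_frame u c.
Hypothesis A_ge1 : loewner_le 1%:M A.
Hypothesis A_le : loewner_le A gamma%:M.
Let rho j := dot (invmx A *m u j) (u j).
Let kappa j := c j * rho j.
Local Notation leb := (borel_lebesgue R n).
Local Notation proj x j := (dot (colvec x) (u j)).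

Let rho_ge j : gamma^-1 <= rho j.
Proof. exact: frame_rho_ge. Qed.

Let rho_gt0 j : 0 < rho j.
Proof. by apply: lt_le_trans (rho_ge j); rewrite invr_gt0. Qed.

Lemma kappa_gt0 j : 0 < kappa j.
Proof. exact: mulr_gt0. Qed.

Let detA_ge1 : 1 <= \det A. Proof. exact: det_frame_ge1. Qed.

Let detA_gt0 : 0 < \det A. Proof. exact: lt_le_trans detA_ge1. Qed.

Let sumk : \sum_j kappa j = n%:R. Proof. exact: sum_kappa. Qed.

Let prod_powR (x : R) : 0 < x -> \prod_j x `^ kappa j = x ^+ n.
Proof.
move=> x0; rewrite -powR_mulrn ?ltW// -sumk.
elim/big_rec2: _ => [|j y z _ ->]; first by rewrite powRr0.
by rewrite powRD// (gt_eqF x0) implybT.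
Qed.

Variables (L : finType) (d : R) (l r : 'I_s -> L -> R).
Hypothesis d_gt0 : 0 < d.
Hypothesis lr : forall j k, l j k <= r j k.
Local Notation F j := (step_fun d (l j) (r j)).
Local Notation S j := (step_mass d (l j) (r j)).

Lemma measurable_prod_step :
  measurable_fun setT (fun x : n.-tuple R => \prod_j F j (proj x j) `^ kappa j).
Proof.
apply: measurable_prod => j _.
apply: (measurableT_comp (measurable_powR (kappa j))).
apply: (measurableT_comp (@measurable_step_fun R L d (l j) (r j))).
exact: measurable_dot_colvec.
Qed.

(** The quantile functions reach only masses below the full Gaussian mass sqrt(pi); using the
    fraction theta of it costs the factor theta^-n. *)
Let step_theta (theta : R) : 0 < theta < 1 ->
  (\int[leb]_x (\prod_j F j (proj x j) `^ kappa j)%:E <=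
   (gamma `^ (n%:R / 2) * (\prod_j S j `^ kappa j) * (theta ^+ n)^-1)%:E)%E.
Proof.
move=> /andP[theta0 theta1].
have pi0 : 0 < Num.sqrt pi :> R by rewrite sqrtr_gt0 pi_gt0.
pose M := theta * Num.sqrt pi.
have M0 : 0 < M by rewrite mulr_gt0.
have Mpi : M < Num.sqrt pi by rewrite -[ltRHS]mul1r ltr_pM2r.
have [I [cell [a [b [y HQ]]]]] := gauss_quantile_exists (ltW M0) Mpi.
(* The target exp(-t^2 / rho_j) is the standard Gaussian scaled by the root of rho_j; then kappa_j
   (T_j / q_j)^2 = c_j T_j^2. *)
pose q j := Num.sqrt (rho j).
have q0 j : 0 < q j by rewrite sqrtr_gt0.
have qq j : q j ^+ 2 = rho j by rewrite sqr_sqrtr// ltW.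
have /choice[cell' /choice[a' /choice[b' H]]] j :=
  step_transport d_gt0 (lr j) M0 (q0 j) HQ.
pose T j t := a' j (cell' j t) * t + b' j (cell' j t).
pose D j := [set t | 0 < F j t].
pose K := \prod_j (S j / (M * q j)) `^ kappa j.
have K0 : 0 <= K by apply: prodr_ge0 => j _; exact: powR_ge0.
pose G x := \1_[set x | forall j, D j (proj x j)] x *
     (\prod_j a' j (cell' j (proj x j)) `^ kappa j *
      expR (- \sum_j c j * T j (proj x j) ^+ 2)).
have mcell j i : measurable (D j `&` cell' j @^-1` [set i]).
  by have [mc _ _ _] := H j; exact: mc.
have mG : measurable_fun setT G :=
  measurable_piecewise_transport u c a' b' mcell.
have le1 : (\int[leb]_x (G x)%:E <= (\det A)^-1%:E *
    \int[leb]_y (expR (- dot (invmx A *m colvec y) (colvec y)))%:E)%E.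
  apply: (@piecewise_transport_le R n s u c c_gt0 A_ge1 _ D cell' a' b').
  - exact: mcell.
  - by move=> j t Dt; have [_ sl _ _] := H j; exact: sl.
  - by move=> j t t' Dt Dt' tt'; have [_ _ inc _] := H j; exact: inc.
(* Where some F_j vanishes the left side is 0 because kappa_j > 0; elsewhere the transport
   inequalities are raised to the powers kappa_j and multiplied. *)
have pointwise x : \prod_j F j (proj x j) `^ kappa j <= K * G x.
  have [Dx|/existsNP[j nDj]] := pselect (forall j, D j (proj x j)); last first.
    rewrite (bigD1 j)//= (_ : F j _ = 0) ?powR0 ?mul0r ?gt_eqF ?kappa_gt0//.
      rewrite mulr_ge0// mulr_ge0// mulr_ge0 ?expR_ge0// prodr_ge0// => i _.
      exact: powR_ge0.
    apply/eqP; rewrite eq_le step_fun_ge0// andbT leNgt; exact/negP.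
  rewrite /G indicE mem_set// mul1r /K -sumrN expR_sum -!big_split /=.
  apply: ler_prod => j _; rewrite powR_ge0 /=.
  have [_ sl _ le] := H j.
  have Mq0 : 0 < M * q j by rewrite mulr_gt0.
  have a0 := sl _ (Dx j).
  apply: (@le_trans _ _ ((S j / (M * q j) *
      (a' j (cell' j (proj x j)) * expR (- (T j (proj x j) / q j) ^+ 2))) `^ kappa j)).
    apply: ge0_ler_powR; rewrite ?nnegrE ?(ltW (kappa_gt0 j)) ?step_fun_ge0//.
      by rewrite mulr_ge0 ?divr_ge0 ?(ltW Mq0) ?step_mass_ge0// mulr_ge0 ?expR_ge0// ltW.
    rewrite [leRHS]mulrAC ler_pdivlMr//; exact: (le _ (Dx j)).
  rewrite powRM ?divr_ge0 ?(ltW Mq0) ?step_mass_ge0//; last first.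
    by rewrite mulr_ge0 ?expR_ge0// ltW.
  rewrite [(a' j _ * _) `^ _]powRM ?expR_ge0 ?(ltW a0)// -expRM.
  rewrite (_ : - _ * kappa j = - (c j * T j (proj x j) ^+ 2))//.
  by rewrite /kappa -(qq j); field; rewrite gt_eqF.
have G0 x : 0 <= G x.
  by rewrite mulr_ge0// mulr_ge0 ?expR_ge0// prodr_ge0// => i _; exact: powR_ge0.
have le2 : (\int[leb]_x (\prod_j F j (proj x j) `^ kappa j)%:E <=
    K%:E * \int[leb]_x (G x)%:E)%E.
  rewrite -ge0_integralZl_EFin//; last 2 first.
  - by move=> x _; rewrite lee_fin.
  - by apply/measurable_EFinP; exact: mG.
  apply: ge0_le_integral => //.
  - by move=> x _; rewrite lee_fin prodr_ge0// => j _; exact: powR_ge0.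
  - by apply/measurable_EFinP; exact: measurable_prod_step.
  - apply/measurable_EFinP; apply: measurable_funM => //; exact: mG.
  - by move=> x _; rewrite -EFinM lee_fin.
apply: (le_trans le2).
apply: (@le_trans _ _ (K%:E * ((\det A)^-1%:E *
  \int[leb]_y (expR (- dot (invmx A *m colvec y) (colvec y)))%:E))%E).
  by apply: lee_wpmul2l; rewrite ?lee_fin.
rewrite integral_expR_invmx; last 2 first.
- exact: weighted_frame_sym.
- exact: (weighted_frame_gt0 A_ge1 c_gt0).
rewrite -!EFinM lee_fin.
pose Q := \prod_j q j `^ kappa j; pose PS := \prod_j S j `^ kappa j.
have PS0 : 0 <= PS by rewrite prodr_ge0// => j _; exact: powR_ge0.
have KE : K * (M ^+ n * Q) = PS.
  rewrite -(prod_powR M0) -!big_split; apply: eq_bigr => j _ /=.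
  have Mq0 : 0 < M * q j by rewrite mulr_gt0.
  rewrite -powRM ?(ltW M0) ?(ltW (q0 j))// -powRM ?divr_ge0 ?step_mass_ge0 ?(ltW Mq0)//.
  by rewrite divfK// gt_eqF.
have sg0 : 0 < Num.sqrt gamma by rewrite sqrtr_gt0.
have gE : gamma `^ (n%:R / 2) = Num.sqrt gamma ^+ n.
  rewrite mulrC powRrM powR12_sqrt ?ltW// powR_mulrn//; exact: ltW.
(* This is where gamma enters: rho_j >= 1 / gamma, and the exponents kappa_j add up to n. *)
have Q_ge : (Num.sqrt gamma ^+ n)^-1 <= Q.
  rewrite -exprVn -prod_powR ?invr_gt0//; apply: ler_prod => j _.
  rewrite powR_ge0/=; apply: ge0_ler_powR; rewrite ?nnegrE ?invr_ge0 ?(ltW sg0)//.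
  + exact/ltW/kappa_gt0.
  + exact: ltW.
  + by rewrite -sqrtrV ?(ltW gamma_gt0)// ler_wsqrtr.
have Q0 : 0 < Q by apply: lt_le_trans Q_ge; rewrite invr_gt0 exprn_gt0.
have Mn0 : 0 < M ^+ n by rewrite exprn_gt0.
have -> : K = PS / (M ^+ n * Q) by rewrite -KE mulfK// gt_eqF// mulr_gt0.
have sD0 : 0 < Num.sqrt (\det A) by rewrite sqrtr_gt0.
have sD1 : 1 <= Num.sqrt (\det A) by rewrite -sqrtr1 ler_wsqrtr.
rewrite gE -/PS.
have -> : (\det A)^-1 = (Num.sqrt (\det A))^-1 * (Num.sqrt (\det A))^-1.
  by rewrite -invfM -expr2 sqr_sqrtr// ltW.
rewrite /M exprMn.
have pin : Num.sqrt pi ^+ n != 0 :> R by rewrite gt_eqF// exprn_gt0.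
have thn : 0 < theta ^+ n by rewrite exprn_gt0.
(* Here x is the root of det A, p the Gaussian constant, which cancels, t = theta^n, q' = [Q] and w
   = [PS]. *)
have simpl (x p t q' w : R) : x != 0 -> p != 0 -> t != 0 -> q' != 0 ->
    w / (t * p * q') * (x^-1 * x^-1 * (x * p)) = w * t^-1 * (q'^-1 * x^-1).
  by move=> x0 p0 t0 q'0; field; rewrite x0 p0 t0 q'0.
rewrite simpl ?(gt_eqF sD0) ?(gt_eqF thn) ?(gt_eqF Q0)//.
rewrite [leRHS]mulrAC [leRHS](_ : _ = PS * (theta ^+ n)^-1 * Num.sqrt gamma ^+ n);
  last by ring.
apply: ler_wpM2l; first by rewrite mulr_ge0// invr_ge0 ltW.
rewrite -[leRHS]mulr1; apply: ler_pM; rewrite ?invr_ge0 ?(ltW Q0) ?(ltW sD0)//.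
  by rewrite -[leRHS]invrK lef_pV2// posrE ?invr_gt0 exprn_gt0.
by rewrite invf_le1.
Qed.

(** The limit theta -> 1, with theta = 1 / (1 + t) and t so small that (1 + t)^n <= 1 + e / (B + 1);
    the denominator is positive even if B = 0. *)
Lemma step_brascamp_lieb :
  (\int[leb]_x (\prod_j F j (proj x j) `^ kappa j)%:E <=
   (gamma `^ (n%:R / 2) * \prod_j S j `^ kappa j)%:E)%E.
Proof.
pose B := gamma `^ (n%:R / 2) * \prod_j S j `^ kappa j.
have B0 : 0 <= B.
  by rewrite mulr_ge0 ?powR_ge0// prodr_ge0// => j _; exact: powR_ge0.
apply/lee_addgt0Pr => e e0.
have [t t0 Ht] := prodr_addr_le (iota 0 n) (fun=> ler01 : 0 <= 1)
  (divr_gt0 e0 (ltr_wpDl B0 ltr01)).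
have th01 : 0 < (1 + t)^-1 < 1.
  by rewrite invr_gt0 ltr_wpDl//= invf_lt1 ?ltrDl// ltr_wpDl.
apply: le_trans (step_theta th01) _.
rewrite -/B -EFinD lee_fin exprVn invrK.
have : (1 + t) ^+ n <= 1 + e / (B + 1).
  by move: Ht; rewrite !big_const_seq !count_predT size_iota !iter_mulr_1 expr1n.
move=> /(ler_wpM2l B0) /le_trans; apply.
rewrite mulrDr mulr1 lerD2l mulrCA -[leRHS]mulr1 ler_pM2l//.
by rewrite ler_pdivrMr ?ltr_wpDl// mul1r lerDl.
Qed.

End step_brascamp_lieb.

(** * Approximation by step functions *)

Section limits_inferior.
Context (R : realType).
Local Open Scope ereal_scope.
Implicit Types (v : (\bar R)^nat).

Lemma limn_einf_ge v (x : \bar R) (k : nat) :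
  (forall i, (k <= i)%N -> x <= v i) -> x <= limn_einf v.
Proof.
move=> vx; rewrite limn_einf_lim.
apply: lime_ge; first exact: is_cvg_einfs.
near=> i; apply: le_ereal_inf_tmp => _ [j /= ij <-]; apply: vx.
by rewrite (leq_trans _ ij)//; near: i; exact: nbhs_infty_ge.
Unshelve. all: by end_near. Qed.

Lemma limn_einf_le v (x : \bar R) : (forall i, v i <= x) -> limn_einf v <= x.
Proof.
move=> vx; rewrite limn_einf_lim.
apply: lime_le; first exact: is_cvg_einfs.
near=> i; apply: (le_trans _ (vx i)); apply: ereal_inf_lbound.
by exists i => /=.
Unshelve. all: by end_near. Qed.

Lemma measurable_fun_limn_einf d (T : measurableType d) (h : (T -> \bar R)^nat) :
  (forall i, measurable_fun setT (h i)) ->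
  measurable_fun setT (fun x => limn_einf (h^~ x)).
Proof.
move=> mh.
have -> : (fun x => limn_einf (h^~ x)) =
    (fun x => - limn_esup (fun i => - h i x)).
  apply/funext => x; rewrite -limn_einfN; congr limn_einf.
  by apply/funext => i /=; rewrite oppeK.
apply: measurableT_comp => //.
apply: (measurable_fun_limn_esup (f := fun i x => - h i x)) => i.
exact: measurableT_comp.
Qed.

(** The integral of a nonnegative function is a supremum over the simple functions below it, hence
    monotone. This serves for x -> f_j(<x, u_j>), whose measurability is never established. *)
Lemma ge0_le_integral_nonmeasurable d (T : measurableType d) (m : {measure set T -> \bar R})
    (f g : T -> \bar R) : (forall x, 0 <= f x) -> (forall x, f x <= g x) ->
  \int[m]_x f x <= \int[m]_x g x.
Proof.
move=> f0 fg; rewrite !ge0_integralTE//; last first.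
  by move=> x; exact: le_trans (fg x).
apply: le_ereal_sup => _ [h /= hf <-]; exists h => // x.
exact: le_trans (fg x).
Qed.

Lemma integralZ_indic d (T : measurableType d) (m : {measure set T -> \bar R})
    (k : R) (A : set T) : (0 <= k)%R -> measurable A ->
  \int[m]_x (k * \1_A x)%:E = k%:E * m A.
Proof.
move=> k0 mA; under eq_integral do rewrite EFinM.
rewrite ge0_integralZl_EFin//; last first.
  by apply/measurable_EFinP; exact: measurable_indic.
by rewrite integral_indic// setIT.
Qed.

Lemma sum_measure_le_integral d (T : measurableType d)
    (m : {measure set T -> \bar R}) (f : T -> R) (k : R) (N : nat)
    (A : 'I_N -> set T) (B : set T) : (0 <= k)%R ->
  measurable_fun setT f -> (forall x, 0 <= f x)%R ->
  (forall i, measurable (A i)) -> measurable B ->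
  (forall x, k * \sum_(i < N) \1_(A i) x <= f x + k * \1_B x)%R ->
  k%:E * \sum_(i < N) m (A i) <= \int[m]_x (f x)%:E + k%:E * m B.
Proof.
move=> k0 mf f0 mA mB le.
have mI (C : set T) : measurable C -> measurable_fun setT (fun x => (k * \1_C x)%:E).
  move=> mC; apply/measurable_EFinP; apply: measurable_funM => //.
have -> : k%:E * \sum_(i < N) m (A i) = \int[m]_x (k * \sum_(i < N) \1_(A i) x)%:E.
  under eq_integral do rewrite mulr_sumr -sumEFin.
  rewrite ge0_integral_sum//; last first.
  - by move=> i x _; rewrite lee_fin mulr_ge0.
  - by move=> i; exact: mI.
  rewrite ge0_sume_distrr//; apply: eq_bigr => i _.
  by rewrite integralZ_indic.
rewrite -integralZ_indic// -ge0_integralD//; last 4 first.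
- by move=> x _; rewrite lee_fin.
- exact/measurable_EFinP.
- by move=> x _; rewrite lee_fin mulr_ge0.
- exact: mI.
apply: ge0_le_integral_nonmeasurable => x; last by rewrite -EFinD lee_fin.
by rewrite lee_fin mulr_ge0// sumr_ge0.
Qed.

End limits_inferior.

(** * Interval coverings and layer-cake sums *)

Section lebesgue_coverings.
Context (R : realType).
Local Notation mu := (@completed_lebesgue_measure R).
Local Notation CR := (caratheodory_type ((@wlength R idfun)^*)%mu).

Lemma completed_lebesgue_measure_itvcc (a b : R) : a <= b ->
  mu `[a, b]%classic = (b - a)%:E.
Proof.
move=> ab; transitivity (@lebesgue_measure R `[a, b]%classic); first by [].
rewrite lebesgue_measure_itv/= lte_fin; case: ltP => [//|ba].
have -> : b = a by apply/eqP; rewrite eq_le ba ab.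
by rewrite subrr.
Qed.

Lemma measurable_completed_itvcc (a b : R) :
  measurable (`[a, b]%classic : set CR).
Proof. by apply: sub_caratheodory; exact: measurable_itv. Qed.

(** [mu] is an infimum over countable coverings by half-open intervals; a nearly optimal one is
    taken. *)
Lemma cover_ocitv (E : set R) (e : R) : (mu E < +oo)%E -> 0 < e ->
  exists l r : nat -> R, [/\ forall k, l k <= r k,
    forall t, E t -> exists k, l k < t <= r k &
    forall K, ((\sum_(k < K) (r k - l k))%:E <= mu E + e%:E)%E].
Proof.
move=> Efin e0.
have muE : mu E \is a fin_num by rewrite ge0_fin_numE.
have [_ [B [mB EB] <-] Be] := lb_ereal_inf_adherent e0 muE.
have /choice[x xB] k : exists x : R * R, `]x.1, x.2]%classic = B k.
  by have [x _ <-] := mB k; exists x.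
(* An empty interval may have its endpoints in the wrong order; the maximum collapses it to length
   0. *)
exists (fun k => (x k).1), (fun k => Num.max (x k).1 (x k).2); split.
- by move=> k; rewrite le_max lexx.
- move=> t /EB[k _]; rewrite -xB /= in_itv/= => /andP[lt tr].
  by exists k; rewrite lt le_max tr orbT.
- move=> K; apply: le_trans (ltW Be).
  apply: (le_trans _ (nneseries_lim_ge K _)); last by move=> k _ _; exact: wlength_ge0.
  rewrite big_mkord -sumEFin; apply: lee_sum => k _.
  apply: (@le_trans _ _ (wlength idfun `](x k).1, (x k).2]%classic)); last by rewrite xB.
  rewrite wlength_itv /= lte_fin; case: ltP => [xx|xx].
    by rewrite EFinB.
  by rewrite subrr.
Qed.

End lebesgue_coverings.

Section layer_cake.
Context (R : realType).

(** The sum rounds a positive [y] up to a multiple of [d], capped at N d. The induction needs the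
    version in which [y] is capped as well. *)
Lemma layer_ge (d y : R) N : 0 < d -> y <= N%:R * d ->
  y <= d * \sum_(i < N) (i%:R * d < y)%R%:R.
Proof.
move=> d0 yN; suff : Num.min y (N%:R * d) <= d * \sum_(i < N) (i%:R * d < y)%R%:R.
  by rewrite min_l.
elim: N {yN} => [|N IH]; first by rewrite mul0r big_ord0 mulr0 ge_min lexx orbT.
rewrite big_ord_recr/= mulrDr; case: ltP => Ny.
  move: IH; rewrite min_r ?(ltW Ny)// => IH.
  by rewrite mulr1 ge_min -natr1 mulrDl mul1r lerD2r IH orbT.
by move: IH; rewrite mulr0 addr0 min_l// => IH; rewrite ge_min IH.
Qed.

(** Rounding up adds at most [d], and only where y > 0, so that the error can be integrated over a
    bounded support. The induction also carries the bound N d. *)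
Lemma layer_le (d y : R) N : 0 < d -> 0 <= y ->
  d * \sum_(i < N) (i%:R * d < y)%R%:R <= y + d * (0 < y)%R%:R.
Proof.
move=> d0 y0.
suff : d * \sum_(i < N) (i%:R * d < y)%R%:R <=
    Num.min (N%:R * d) (y + d * (0 < y)%R%:R).
  by rewrite le_min => /andP[].
have yd : 0 <= y + d * (0 < y)%R%:R by rewrite addr_ge0// mulr_ge0// ltW.
elim: N => [|N IH]; first by rewrite big_ord0 mulr0 mul0r le_min lexx yd.
rewrite big_ord_recr/= mulrDr; case: (ltP (N%:R * d) y) => Ny.
  have -> : (0 < y) = true by rewrite (le_lt_trans _ Ny)// mulr_ge0// ltW.
  rewrite le_min !mulr1 -natr1 mulrDl mul1r !lerD2r.
  by move: IH; rewrite le_min => /andP[dS _]; rewrite dS (le_trans dS (ltW Ny)).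
rewrite mulr0 addr0; apply: le_trans IH _.
by rewrite le_min !ge_min lexx orbT andbT -natr1 mulrDl mul1r lerDl ltW.
Qed.

End layer_cake.

Section step_approximation.
Context (R : realType).
Local Notation mu := (@completed_lebesgue_measure R).
Local Notation CR := (caratheodory_type ((@wlength R idfun)^*)%mu).
Variables (f : R -> R) (m : R).
Hypothesis mf : lebesgue_measurable_fun f.
Hypothesis m_gt0 : 0 < m.
Hypothesis f_ge0 : forall t, 0 <= f t.
Hypothesis f_le : forall t, f t <= m.
Hypothesis f_supp : forall t, 0 < f t -> - m <= t <= m.

Let level_measurable (a : R) : measurable [set t : CR | a < f t].
Proof.
have ma : measurable_fun [set: CR] (fun t : CR => a < f t).
  exact: measurable_fun_ltr.
by rewrite -[X in measurable X]setTI; exact: (ma measurableT [set true]).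
Qed.

Let completed_itvcc : mu (`[- m, m]%classic : set CR) = (2 * m)%:E.
Proof.
transitivity (m - - m)%:E; last by congr EFin; ring.
by apply: completed_lebesgue_measure_itvcc; move: m_gt0; lra.
Qed.

Let level_le (a : R) : 0 <= a -> (mu [set t | (a < f t)%R] <= (2 * m)%:E)%E.
Proof.
move=> a0; rewrite -completed_itvcc.
apply: le_outer_measure => t /= at_; rewrite in_itv/=; apply: f_supp.
exact: le_lt_trans at_.
Qed.

Lemma bounded_integral_lty : (\int[mu]_(t in setT) (f t)%:E < +oo)%E.
Proof.
apply: (@le_lt_trans _ _ (\int[mu]_t (m * \1_(`[- m, m]%classic) t)%:E)%E).
  apply: ge0_le_integral_nonmeasurable => t; rewrite lee_fin//.
  have [ft|ft] := ltP 0 (f t); last first.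
    by apply: le_trans ft _; rewrite mulr_ge0// ltW.
  by rewrite indicE mem_setE in_itv/= f_supp// mulr1.
rewrite integralZ_indic ?(ltW m_gt0)//; last exact: measurable_completed_itvcc.
by rewrite [X in (_ * X < _)%E]completed_itvcc ltry.
Qed.

Let layer_integral (d : R) N : 0 < d ->
  ((d%:E * \sum_(i < N) mu [set t | (i%:R * d < f t)%R]) <=
   \int[mu]_(t in setT) (f t)%:E + (d * (2 * m))%:E)%E.
Proof.
move=> d0.
rewrite EFinM -completed_itvcc.
apply: (@sum_measure_le_integral _ _ _ mu f d N
  (fun i : 'I_N => [set t : CR | (i%:R * d < f t)%R]) `[- m, m]%classic).
- exact: ltW.
- exact: mf.
- exact: f_ge0.
- by move=> i; exact: level_measurable.
- exact: measurable_completed_itvcc.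
move=> t; rewrite (eq_bigr (fun i : 'I_N => (i%:R * d < f t)%R%:R)); last first.
  by move=> i _; rewrite indicE; congr (nat_of_bool _)%:R; apply/idP/idP; rewrite inE.
apply: le_trans (layer_le N d0 (f_ge0 t)) _.
rewrite lerD2l ler_wpM2l ?(ltW d0)// indicE mem_setE in_itv/=.
by case: ltP => // /f_supp ->.
Qed.

(** Each level set {f > i d} is covered by intervals of height [d], with excess length [e]. Rounding
    costs d times 2m, and the N+1 coverings cost (N+1) d e = m e. Only the first K intervals of each
    covering are used, so domination at a given point holds from some K on. *)
Lemma step_approximation N (e : R) : 0 < e -> let d := m / N.+1%:R in
  exists l r : 'I_N.+1 -> nat -> R,
  [/\ forall i k, l i k <= r i k,
      forall t, exists K0, forall K, (K0 <= K)%N ->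
        f t <= step_fun d (fun p : 'I_N.+1 * 'I_K => l p.1 p.2)
                          (fun p => r p.1 p.2) t &
      forall K, ((step_mass d (fun p : 'I_N.+1 * 'I_K => l p.1 p.2)
                          (fun p => r p.1 p.2))%:E <=
        \int[mu]_(t in setT) (f t)%:E + (d * (2 * m) + m * e)%:E)%E].
Proof.
move=> e0 d; have d0 : 0 < d by rewrite divr_gt0.
have dN : d * N.+1%:R = m by rewrite /d divfK// pnatr_eq0.
pose E (i : 'I_N.+1) : set R := [set t | i%:R * d < f t].
have E_le i : (mu (E i) <= (2 * m)%:E)%E by apply: level_le; rewrite mulr_ge0// ltW.
have E_fin i : (mu (E i) < +oo)%E by exact: le_lt_trans (E_le i) (ltry _).
have /choice[l /choice[r lr]] i := cover_ocitv (E_fin i) e0.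
exists l, r; split.
- by move=> i k; have [H _ _] := lr i; exact: H.
- move=> t.
  have /choice[kk Hk] (i : 'I_N.+1) : exists k, i%:R * d < f t -> l i k < t <= r i k.
    have [Et|nEt] := pselect (E i t); last by exists 0%N.
    by have [_ /(_ _ Et)[k Hk] _] := lr i; exists k.
  (* There are finitely many levels, so one threshold serves all of them at [t]. *)
  exists (\max_i (kk i).+1)%N => K K0K.
  apply: (@le_trans _ _ (d * \sum_(i < N.+1) (i%:R * d < f t)%R%:R)).
    by apply: layer_ge => //; rewrite mulrC dN.
  rewrite /step_fun ler_pM2l// -(pair_bigA _ (fun (i : 'I_N.+1) (k : 'I_K) => (l i k < t <= r i k)%R%:R)) /=.
  apply: ler_sum => i _; case: (ltP (i%:R * d) (f t)) => [Et|_]; last by rewrite sumr_ge0.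
  have kK : (kk i < K)%N.
    by apply: leq_trans K0K; exact: (@leq_bigmax _ (fun i => (kk i).+1) i).
  by rewrite (bigD1 (Ordinal kK))//= Hk// lerDl sumr_ge0.
- move=> K; rewrite /step_mass.
  rewrite -(pair_bigA _ (fun (i : 'I_N.+1) (k : 'I_K) => r i k - l i k)) /=.
  apply: (@le_trans _ _ (d%:E * \sum_(i < N.+1) (mu (E i) + e%:E))%E).
    rewrite EFinM; apply: lee_wpmul2l; first by rewrite lee_fin ltW.
    rewrite -sumEFin; apply: lee_sum => i _.
    by have [_ _ H] := lr i; exact: H.
  rewrite big_split /= ge0_muleDr ?sume_ge0// => [|i _]; last by rewrite lee_fin ltW.
  rewrite EFinD addeA; apply: leeD; first exact: layer_integral.
  rewrite sumEFin sumr_const card_ord -EFinM lee_fin -mulr_natl mulrA dN//.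
Qed.

End step_approximation.

(** * The inequality for bounded functions of bounded support *)

Section bounded_brascamp_lieb.
Context (R : realType) (n s : nat) (gamma : R) (u : 'I_s -> 'cV[R]_n) (c : 'I_s -> R).
Hypothesis gamma_gt0 : 0 < gamma.
Hypothesis u1 : forall j, dot (u j) (u j) = 1.
Hypothesis c_gt0 : forall j, 0 < c j.
Let A := weighted_frame u c.
Hypothesis A_ge1 : loewner_le 1%:M A.
Hypothesis A_le : loewner_le A gamma%:M.
Let kappa j := c j * dot (invmx A *m u j) (u j).
Local Notation leb := (borel_lebesgue R n).
Local Notation proj x j := (dot (colvec x) (u j)).
Local Notation mu := (@completed_lebesgue_measure R).
Let C := gamma `^ (n%:R / 2).

Let k0 j : 0 < kappa j.
Proof. exact: (kappa_gt0 gamma_gt0 u1 c_gt0 A_ge1 A_le). Qed.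

Variables (f : 'I_s -> R -> R) (m : R).
Hypothesis mf : forall j, lebesgue_measurable_fun (f j).
Hypothesis m_gt0 : 0 < m.
Hypothesis f_ge0 : forall j t, 0 <= f j t.
Hypothesis f_le : forall j t, f j t <= m.
Hypothesis f_supp : forall j t, 0 < f j t -> - m <= t <= m.

Let Int j : R := fine (\int[mu]_(t in setT) (f j t)%:E).

Let Int_ge0 j : 0 <= Int j.
Proof. by apply: fine_ge0; apply: integral_ge0 => t _; rewrite lee_fin. Qed.

Let IntE j : (\int[mu]_(t in setT) (f j t)%:E)%E = (Int j)%:E.
Proof.
rewrite fineK// ge0_fin_numE; first exact: (bounded_integral_lty m_gt0 (f_ge0 j) (f_le j) (@f_supp j)).
by apply: integral_ge0 => t _; rewrite lee_fin.
Qed.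

(** [H] is the lower limit, as K grows, of the products for the dominating step functions; Fatou's
    lemma bounds its integral. A Borel majorant stands in for the product of the f_j, so that
    Fatou's lemma can be applied once more later. *)
Lemma bounded_brascamp_lieb (e : R) : 0 < e ->
  exists H : n.-tuple R -> \bar R,
  [/\ measurable_fun setT H, forall x, (0 <= H x)%E,
      forall x, ((\prod_j f j (proj x j) `^ kappa j)%:E <= H x)%E &
      (\int[leb]_x H x <= (C * (\prod_j Int j `^ kappa j + e))%:E)%E].
Proof.
move=> e0.
have C0 : 0 <= C by exact: powR_ge0.
have [t t0 Ht] := @prodr_addr_le _ _ (index_enum 'I_s) (fun j => Int j `^ kappa j) e
  (fun j => powR_ge0 _ _) e0.
have [tau tau0 Htau] : exists2 tau, 0 < tau & forall j, (Int j + tau) `^ kappa j <= Int j `^ kappa j + t.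
  (* [z j] is the value whose power kappa_j is exactly [t] above that of the integral; [tau] is the
     least gap, with default 1 so that it is positive even when s = 0. *)
  pose z j := (Int j `^ kappa j + t) `^ (kappa j)^-1.
  have wpos j : 0 <= Int j `^ kappa j + t by rewrite addr_ge0 ?powR_ge0 ?ltW.
  have zE j : z j `^ kappa j = Int j `^ kappa j + t.
    by rewrite /z -powRrM mulVf ?gt_eqF// powRr1.
  have zI j : Int j < z j.
    rewrite ltNge; apply/negP => zj.
    have : z j `^ kappa j <= Int j `^ kappa j.
      by apply: ge0_ler_powR; rewrite ?nnegrE ?powR_ge0 ?Int_ge0 ?(ltW (k0 j)).
    by rewrite zE gerDl leNgt t0.
  exists (\big[Num.min/1]_j (z j - Int j)).
    by elim/big_ind: _ => // [a b a0 b0|j _]; rewrite ?lt_min ?a0// subr_gt0.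
  move=> j; rewrite -(zE j); apply: ge0_ler_powR; rewrite ?nnegrE ?powR_ge0 ?(ltW (k0 j))//.
    rewrite addr_ge0//; elim/big_ind: _ => // [a b a0 b0|i _]; rewrite ?le_min ?a0//.
    by rewrite subr_ge0 ltW.
  by rewrite -lerBrDl; exact: bigmin_le_cond.
(* One half of [tau] pays for the rounding error, the other, as m times the covering error
   [tau / 2 / m], for the coverings. *)
have [N HN] : exists N : nat, m / N.+1%:R * (2 * m) <= tau / 2.
  have q0 : 0 < tau / 2 / (m * (2 * m)) by rewrite !divr_gt0 ?mulr_gt0.
  have [N _ qN] := near_infty_natSinv_lt (PosNum q0).
  exists N; have /= := qN N (leqnn N).
  rewrite ltr_pdivlMr ?mulr_gt0// => /ltW; apply: le_trans.
  by rewrite le_eqVlt; apply/orP; left; apply/eqP; ring.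
have eta0 : 0 < tau / 2 / m by rewrite !divr_gt0.
have /choice[l /choice[r lr]] j := step_approximation (mf j) m_gt0 (f_ge0 j)
  (f_le j) (@f_supp j) N eta0.
pose d := m / N.+1%:R; have d0 : 0 < d by rewrite divr_gt0.
pose L K (j : 'I_s) (p : 'I_N.+1 * 'I_K) := l j p.1 p.2.
pose U K (j : 'I_s) (p : 'I_N.+1 * 'I_K) := r j p.1 p.2.
have LU K j p : @L K j p <= @U K j p.
  by have [H _ _] := lr j; exact: H.
pose v K (x : n.-tuple R) : \bar R :=
  (\prod_j step_fun d (@L K j) (@U K j) (proj x j) `^ kappa j)%:E.
have v0 K x : (0 <= v K x)%E.
  by rewrite lee_fin prodr_ge0// => j _; exact: powR_ge0.
have mv K : measurable_fun setT (v K).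
  by apply/measurable_EFinP; exact: measurable_prod_step.
exists (fun x => limn_einf (v^~ x)); split.
- exact: measurable_fun_limn_einf.
- by move=> x; apply: (@limn_einf_ge _ _ _ 0%N) => K _.
- move=> x.
  have /choice[K0 HK0] j : exists K0, forall K, (K0 <= K)%N ->
      f j (proj x j) <= step_fun d (@L K j) (@U K j) (proj x j).
    by have [_ /(_ (proj x j)) H _] := lr j; exact: H.
  apply: (@limn_einf_ge _ _ _ (\max_j K0 j)) => K KK.
  rewrite lee_fin; apply: ler_prod => j _; rewrite powR_ge0/=.
  apply: ge0_ler_powR; rewrite ?nnegrE ?(ltW (k0 j))//; first exact: step_fun_ge0.
  by apply: HK0; apply: leq_trans KK; exact: leq_bigmax.
- apply: (le_trans (fatou _ measurableT mv (fun K x _ => v0 K x))).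
  apply: limn_einf_le => K.
  apply: (le_trans (step_brascamp_lieb gamma_gt0 u1 c_gt0 A_ge1 A_le d0 (LU K))).
  rewrite lee_fin ler_wpM2l//; apply: le_trans Ht.
  apply: ler_prod => j _; rewrite powR_ge0/=; apply: le_trans (Htau j).
  apply: ge0_ler_powR; rewrite ?nnegrE ?(ltW (k0 j)) ?step_mass_ge0//.
    by rewrite addr_ge0// ltW.
  have [_ _ /(_ K)] := lr j; rewrite IntE -EFinD lee_fin => /le_trans; apply.
  rewrite lerD2l (splitr tau) lerD// le_eqVlt; apply/orP; left; apply/eqP.
  by field; rewrite gt_eqF.
Qed.

End bounded_brascamp_lieb.

(** * Passage to the completed measure and to general functions *)

Lemma integral_lebesgue_Rn (R : realType) (n : nat) (H : n.-tuple R -> \bar R) :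
  measurable_fun setT H -> (forall x, (0 <= H x)%E) ->
  (\int[lebesgue_Rn R n]_(x in setT) H x = \int[borel_lebesgue R n]_x H x)%E.
Proof.
move=> mH H0.
pose CT := caratheodory_type ((borel_lebesgue R n)^*)%mu.
(* The identity changes only the sigma-algebra; it pushes the completed measure forward to the Borel
   one. *)
pose i : CT -> n.-tuple R := id.
have mi : measurable_fun setT i.
  move=> _ Y mY; rewrite setTI; apply: sub_caratheodory.
  exact: sub_sigma_algebra.
transitivity (\int[pushforward (lebesgue_Rn R n) i]_x H x)%E.
  by rewrite ge0_integral_pushforward.
by apply: eq_measure_integral => B mB _; exact: lebesgue_RnE.
Qed.

Lemma prode_EFin (R : realType) (I : Type) (s : seq I) (a : I -> R) :
  (\prod_(i <- s) (a i)%:E = (\prod_(i <- s) a i)%:E)%E.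
Proof. by elim/big_rec2: _ => // i x y _ ->. Qed.

Lemma lee_prod (R : realType) (I : Type) (s : seq I) (a b : I -> \bar R) :
  (forall i, 0 <= a i <= b i)%E ->
  (\prod_(i <- s) a i <= \prod_(i <- s) b i)%E.
Proof.
move=> ab; suff /andP[] : (0 <= \prod_(i <- s) a i <= \prod_(i <- s) b i)%E by [].
elim/big_rec2: _ => [|i x y _ /andP[x0 xy]]; first by rewrite lee01 lexx.
have /andP[a0 abi] := ab i.
by rewrite mule_ge0//= lee_pmul.
Qed.

Theorem theorem1p5 (R : realType) (n s : nat) (gamma : R)
    (u : 'I_s -> 'cV[R]_n) (c : 'I_s -> R) (f : 'I_s -> R -> R) :
  1 < gamma ->
  (forall j, unit_sphere R n (u j)) ->
  (forall j, 0 < c j) ->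
  let A : 'M[R]_n := \sum_(j < s) c j *: tensor (u j) (u j) in
  loewner_le 1%:M A ->
  loewner_le A (gamma%:M) ->
  let kappa : 'I_s -> R := fun j => c j * dot (invmx A *m u j) (u j) in
  (forall j, lebesgue_measurable_fun (f j)) ->
  (forall j t, 0 <= f j t) ->
  (forall j, 0 < kappa j) /\
  (\int[lebesgue_Rn R n]_(x in setT)
      (\prod_(j < s) (f j (dot (colvec x) (u j)) `^ kappa j))%:E <=
   (gamma `^ (n%:R / 2))%:E *
   \prod_(j < s)
     ((\int[completed_lebesgue_measure]_(t in setT) (f j t)%:E) `^ kappa j))%E.
Proof.
move=> gamma1 u_sphere c_gt0 A A_ge1 A_le kappa mf f_ge0.
have gamma_gt0 : 0 < gamma by apply: lt_trans gamma1.
have u1 j : dot (u j) (u j) = 1.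
  have : enorm (u j) = 1 := u_sphere j.
  by rewrite /enorm => e1; rewrite -(sqr_sqrtr (dot_ge0 (u j))) e1 expr1n.
have k0 j : 0 < kappa j by exact: (kappa_gt0 gamma_gt0 u1 c_gt0 A_ge1 A_le).
split=> //.
pose B := (\prod_(j < s) ((\int[completed_lebesgue_measure]_(t in setT) (f j t)%:E) `^ kappa j))%E.
pose C := gamma `^ (n%:R / 2); have C0 : 0 < C by exact: powR_gt0.
apply/lee_addgt0Pr => e e0.
(* Height and support are both cut at m + 1, the single positive bound expected by
   [bounded_brascamp_lieb]. *)
pose trunc (m : nat) j (t : R) :=
  Num.min (f j t) m.+1%:R * \1_(`[- m.+1%:R, m.+1%:R]%classic) t.
have trunc0 m j t : 0 <= trunc m j t by rewrite mulr_ge0// le_min f_ge0/=.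
have trunc_le m j t : trunc m j t <= f j t.
  by rewrite -[leRHS]mulr1 ler_pM// ?le_min ?f_ge0//= ?ge_min ?lexx//.
have trunc_lem m j t : trunc m j t <= m.+1%:R.
  by rewrite -[leRHS]mulr1 ler_pM// ?le_min ?f_ge0//= ?ge_min ?lexx ?orbT//.
have mtrunc m j : lebesgue_measurable_fun (trunc m j).
  apply: measurable_funM; first exact: measurable_minr (mf j) (measurable_cst _).
  exact/measurable_indic/measurable_completed_itvcc.
have trunc_supp m j t : 0 < trunc m j t -> - m.+1%:R <= t <= m.+1%:R.
  rewrite /trunc indicE mem_setE in_itv/=; case: (_ <= _ <= _) => //.
  by rewrite mulr0 ltxx.
(* The error term is later multiplied by [C], which gives back [e]. *)
have eC0 : 0 < e / C by rewrite divr_gt0.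
have /choice[H HP] m := bounded_brascamp_lieb gamma_gt0 u1 c_gt0 A_ge1 A_le
  (mtrunc m) (ltr0Sn R m) (trunc0 m) (trunc_lem m) (trunc_supp m) eC0.
have mH m : measurable_fun setT (H m) by have [] := HP m.
have H0 m x : (0 <= H m x)%E by have [_ h _ _] := HP m; exact: h.
pose G x := limn_einf (H^~ x).
have mG : measurable_fun setT G by exact: measurable_fun_limn_einf.
have G0 x : (0 <= G x)%E by apply: (@limn_einf_ge _ _ _ 0%N) => m _.
apply: (@le_trans _ _ (\int[lebesgue_Rn R n]_(x in setT) G x)%E).
  apply: ge0_le_integral_nonmeasurable => x.
    by rewrite lee_fin prodr_ge0// => j _; exact: powR_ge0.
  (* At a fixed x, once m + 1 is at least f_j(<x, u_j>) and |<x, u_j>| for all j, truncation changes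
     nothing, so the lower limit [G] dominates the integrand. *)
  have /choice[M HM] j : exists M, forall m, (M <= m)%N ->
      trunc m j (dot (colvec x) (u j)) = f j (dot (colvec x) (u j)).
    set t := dot _ _; pose b := Num.max (f j t) `|t|.
    have b0 : 0 <= b by rewrite le_max f_ge0.
    exists (Num.truncn b) => m bm.
    have : b <= m.+1%:R.
      by apply: (le_trans (ltW (truncnS_gt b))); rewrite ler_nat.
    rewrite ge_max => /andP[fm tm].
    rewrite /trunc min_l// indicE mem_setE in_itv/=.
    by rewrite -ler_norml tm mulr1.
  apply: (@limn_einf_ge _ _ _ (\max_j M j)) => m Mm.
  have [_ _ h _] := HP m; apply: le_trans (h x).
  rewrite lee_fin le_eqVlt; apply/orP; left; apply/eqP.
  apply: eq_bigr => j _; rewrite HM//.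
  by apply: leq_trans Mm; exact: leq_bigmax.
rewrite integral_lebesgue_Rn//.
apply: (le_trans (fatou _ measurableT mH (fun m x _ => H0 m x))).
apply: limn_einf_le => m; have [_ _ _ le] := HP m.
apply: (le_trans le).
rewrite mulrDr EFinD (mulrC C (e / C)) divfK ?gt_eqF// leeD2r//.
rewrite EFinM; apply: lee_wpmul2l; first by rewrite lee_fin ltW.
rewrite -prode_EFin; apply: lee_prod => j.
rewrite lee_fin powR_ge0 /= -poweR_EFin.
have int0 (h : R -> R) : (forall t, 0 <= h t) ->
    (0 <= \int[completed_lebesgue_measure]_(t in setT) (h t)%:E)%E.
  by move=> h0; apply: integral_ge0 => t _; rewrite lee_fin.
(* The truncated integrals are finite, so [fine] loses nothing; the integrals of the f_j themselves
   may be infinite, hence the comparison of powers in the extended reals. *)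
rewrite fineK; last first.
  rewrite ge0_fin_numE; last exact: int0.
  exact: (bounded_integral_lty (ltr0Sn R m) (trunc0 m j) (trunc_lem m j) (@trunc_supp m j)).
apply: gt0_ler_poweR; rewrite ?(ltW (k0 j))// ?in_itv /= ?leey ?andbT ?int0//.
apply: ge0_le_integral_nonmeasurable => t; rewrite lee_fin//.
Qed.
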